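(* Let $\Phi$ be a strictly convex differentiable nice Young function. Assume that, on $(0,+\infty)$, $\Phi(x)/x^2$ is non-decreasing and that there exists $\theta>2$ such that $\Phi(x)/x^\theta$ is non-increasing. Let $d\mu(x)=e^{-V(x)}dx$ be a probability measure on $\mathbb R$. Assume that $V$ is locally bounded, of class $\mathcal C^2$ in neighborhoods of $+\infty$ and $-\infty$, and such that: (i) $\displaystyle\liminf_{|x|\to+\infty}\mathrm{sign}(x)V'(x)>0$, (ii) $\displaystyle-1<\liminf_{|x|\to+\infty}\frac{V''(x)}{V'(x)^2}\le\limsup_{|x|\to+\infty}\frac{V''(x)}{V'(x)^2}<\frac1\theta$, (iii) $\displaystyle\limsup_{|x|\to+\infty}\frac{V(x)}{\Phi(|V'(x)|)}<+\infty$. Then there exists a constant $\kappa<+\infty$ such that for all locally Lipschitz $f$ on $\mathbb R$, $$\mathbf{Ent}_\mu(f^2)\le\kappa\int_{\mathbb R}H_\Phi\left(\frac{f'}{f}\right)f^2\,d\mu.$$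
   Context: A nice Young function is an even convex function $\Phi:\mathbb R\to[0,+\infty)$ with $\Phi(0)=0$, $\Phi'(0)=0$, $\lim_{x\to+\infty}\Phi(x)/x=+\infty$, vanishing only at $0$. Its modification is $H_\Phi(x)=x^2$ if $|x|\le1$ and $H_\Phi(x)=\Phi(|x|)/\Phi(1)$ if $|x|>1$. $\mathbf{Ent}_\mu(g)=\int g\log g\,d\mu-(\int g\,d\mu)\log(\int g\,d\mu)$. For a locally Lipschitz $f$, $|f'|(x)=\lim_{r\to0^+}\sup_{|x-y|\le r}\frac{|f(x)-f(y)|}{|x-y|}$, equal almost everywhere to the absolute value of the usual derivative; only $|f'|$ matters since $H_\Phi$ is even. The integrand $H_\Phi(f'/f)f^2$ is read as $0$ at points where $f=0$ (where $f'=0$ almost everywhere). *)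

(* Defs.v *)
From HB Require Import structures.
From mathcomp Require Import all_boot all_order all_algebra.
From mathcomp Require Import all_classical all_reals all_analysis.

Set Implicit Arguments.
Unset Strict Implicit.
Unset Printing Implicit Defensive.

Import Order.TTheory GRing.Theory Num.Theory.
Import numFieldNormedType.Exports.

Local Open Scope classical_set_scope.
Local Open Scope ring_scope.

Section definitions.
Context {R : realType}.
Implicit Types (Phi V f g : R -> R) (x y : R).

Record nice_young Phi : Prop := NiceYoung {
  nice_young_ge0 : forall x, 0 <= Phi x ;
  nice_young_even : forall x, Phi (- x) = Phi x ;
  nice_young_convex : convex_function [set: R] Phi ;
  nice_young_at0 : Phi 0 = 0 ;
  nice_young_derive0 : is_derive (0 : R) (1 : R) Phi 0 ;
  nice_young_superlinear : Phi x / x @[x --> +oo] --> +oo ;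
  nice_young_eq0 : forall x, Phi x = 0 -> x = 0 }.

Definition strictly_convex Phi : Prop :=
  forall x y (t : R), x != y -> 0 < t < 1 ->
    Phi (t * x + (1 - t) * y) < t * Phi x + (1 - t) * Phi y.

Definition modification Phi : R -> R := fun x =>
  if `|x| <= 1 then x ^+ 2 else Phi `|x| / Phi 1.

(** The filter of the neighbourhoods of infinity, i.e. "|x| -> +oo". *)
Definition abs_infty : set_system R :=
  filter_from [set: R] (fun M => [set x | M < `|x|]).

Definition locally_bounded V : Prop := forall x, bounded_near V (nbhs x).

Definition C2_near_infty V : Prop :=
  \forall x \near abs_infty,
    [/\ derivable V x 1, derivable V^`()%classic x 1 & {for x, continuous V^`(2)%classic}].

Definition locally_lipschitz f : Prop :=
  forall x, exists2 U, nbhs x U & [lipschitz f y | y in U].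

(** The local slope |f'|(x); it is finite when f is locally Lipschitz. *)
Definition abs_deriv f x : R :=
  fine (lim (ereal_sup [set (`|f x - f y| / `|x - y|)%:E
                        | y in [set y | 0 < `|x - y| <= r]] @[r --> 0^'+])).

Definition has_density_expN (mu : set (measurableTypeR R) -> \bar R) V : Prop :=
  measurable_fun [set: measurableTypeR R] V /\
  forall A : set (measurableTypeR R), measurable A ->
    mu A = (\int[lebesgue_measure]_(x in A) (expR (- V x))%:E)%E.

(** Entropy of a nonnegative function. Since [ln 0 = 0], the integrand
  [g * ln g] vanishes where [g] does. As [t * ln t >= - expR (-1)] for t >= 0,
  the integral of [g * ln g] always makes sense in ]-oo, +oo]. If [g] is not
  integrable the difference below would read +oo - +oo (which is -oo in
  [\bar R]), and the entropy is +oo by convention. *)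
Definition entropy (mu : {measure set (measurableTypeR R) -> \bar R}) g
    : \bar R :=
  if `[< mu.-integrable [set: R] (EFin \o g) >] then
    let m := fine (\int[mu]_x (g x)%:E)%E in
    (\int[mu]_x (g x * ln (g x))%:E - (m * ln m)%:E)%E
  else +oo%E.

(** The integral of H_Phi(f'/f) f^2; since [0^-1 = 0], the integrand is 0
  where f vanishes, and only |f'| matters since H_Phi is even. *)
Definition modified_energy Phi (mu : {measure set (measurableTypeR R) -> \bar R})
    f : \bar R :=
  (\int[mu]_x (modification Phi (abs_deriv f x / f x) * f x ^+ 2)%:E)%E.

End definitions.

(* Main.v *)
Require Import Defs.
From mathcomp Require Import all_boot all_order all_algebra.
From mathcomp Require Import all_classical all_reals all_analysis.
From mathcomp Require Import measurable_realfun ring lra.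
Import Order.TTheory GRing.Theory Num.Theory.
Import numFieldNormedType.Exports.
Local Open Scope classical_set_scope.
Local Open Scope ring_scope.

(** Write [|f'|] for the local slope, [h = max(|f|, K)] and [E] for the modified
  energy. Differentiating [Phi(V'(1 - K/h)) h^2 / V' * e^-V] on the tails,
  the condition [V''/V'^2 <= q < 1/theta] together with
  [Phi(x) <= x Phi'(x) <= theta Phi(x)] shows that the term coming from [V']
  is absorbed, so that [int Phi(V'(1 - K/h)) h^2 dmu] over a tail is at most a
  constant times [E]; the factor [1 - K/h] vanishes where [|f| <= K], so no
  multiple of [int f^2] is lost. A weighted Poincare inequality gives
  [int (|f| - 1)^2 dmu <= C E] when [int f^2 dmu = 1], and integrating
  [|f'| <= (|f'|^2 e^-V + e^V) / 2] gives [|f| <= C (1 + E) e^V].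
  Where [|f| <= 2K] the entropy density is at most [C (|f| - 1)^2]; where
  [|f| > 2K] one has [log f^2 <= C + 2E + 2V], and [V <= C Phi(V')] brings the
  last term back to the tail estimate. *)

(** * Slopes along difference quotients *)

Section slope_calculus.
Context {R : realType}.
Implicit Types (F G phi : R -> R) (x a c : R).

(** Since [f] is only locally Lipschitz, no derivative of [f] is ever taken: the chain and product
    rules are run on [slope], which carries an error term, and all that depends on [f] is put into
    that error. The local slope is replaced by the smaller, measurable [seq_slope], which is
    harmless because [modification Phi] is monotone in absolute value. The inequality allows no
    additive multiple of [int f^2], and this shapes the rest. After normalising [int f^2 dmu = 1],
    the entropy is the integral of [ent_density f], which is nonnegative and of second order at
    [f = 1], so the centre [[-M, M]] and the two tails can be bounded separately. The boundary term
    of the tail estimate must itself be a multiple of [E]. For this, [K] is taken with [K^2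
    mu([-M, M]) > 1], which yields a point [x0] of the centre with [f x0 <= K]; then
    [Phi (l x) <= l^2 Phi x] for [l <= 1] turns the boundary term into a multiple of
    [(max(f, K) - K)^2] at an end of the centre, an oscillation that [E] controls. *)

Definition diff_quot F x (n : nat) : R := (F (x + n.+1%:R^-1) - F x) * n.+1%:R.

(** [F] behaves at [x] like a function of derivative [a], up to an error of
  slope [c]. Only right difference quotients along [1/(n+1)] are involved: this
  keeps the best [c] measurable in [x] and is all that [ftc_le] needs. *)
Definition slope F x a c : Prop :=
  forall eta : R, 0 < eta -> \forall n \near \oo, `|diff_quot F x n - a| <= c + eta.

Lemma diff_quot_incr F x n : F (x + n.+1%:R^-1) - F x = diff_quot F x n / n.+1%:R.
Proof. by rewrite /diff_quot mulfK// pnatr_eq0. Qed.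

Lemma slope_shift {F x a c} : slope F x a c ->
  F (x + n.+1%:R^-1) @[n --> \oo] --> F x.
Proof.
move=> Fs; apply/cvgrPdist_le => e e0.
have C0 : 0 < `|a| + `|c| + 1 by rewrite ltr_wpDl// addr_ge0.
near=> n.
rewrite distrC diff_quot_incr normrM normfV.
have dn : `|diff_quot F x n| <= `|a| + `|c| + 1.
  have : `|diff_quot F x n - a| <= c + 1 by near: n; exact: Fs.
  move=> h; rewrite -[diff_quot F x n](subrK a) (le_trans (ler_normD _ _))//.
  rewrite (le_trans (lerD h (lexx _)))//.
  by rewrite addrC addrA lerD2r lerD2l ler_norm.
rewrite [`|n.+1%:R|]ger0_norm// ler_pdivrMr ?ltr0n//.
rewrite (le_trans dn)// -ler_pdivrMl//.
rewrite mulrC.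
have := archi_boundP (ltW (divr_gt0 C0 e0)).
set N := Num.bound _ => CN; rewrite (le_trans (ltW CN))// ler_nat.
by near: n; exists N => // n /= /leq_trans; apply.
Unshelve. all: by end_near. Qed.

Lemma slope_diff_quot_bound {F x a c} : slope F x a c ->
  \forall n \near \oo, `|diff_quot F x n| <= `|a| + c + 1.
Proof.
move=> Fs; near=> n; rewrite -[diff_quot F x n](subrK a) (le_trans (ler_normD _ _))//.
rewrite addrC -addrA lerD2l; near: n; exact: Fs.
Unshelve. all: by end_near. Qed.

Lemma slopeN {F x a c} : slope F x a c -> slope (fun y => - F y) x (- a) c.
Proof.
move=> Fs e e0; near=> n.
have -> : diff_quot (fun y => - F y) x n - - a = - (diff_quot F x n - a) by rewrite /diff_quot; ring.
by rewrite normrN; near: n; exact: Fs.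
Unshelve. all: by end_near. Qed.

Lemma slopeD {F G x a c a' c'} : slope F x a c -> slope G x a' c' ->
  slope (fun y => F y + G y) x (a + a') (c + c').
Proof.
move=> Fs Gs e e0; near=> n.
have -> : diff_quot (fun y => F y + G y) x n - (a + a') =
  (diff_quot F x n - a) + (diff_quot G x n - a') by rewrite /diff_quot; ring.
have -> : c + c' + e = (c + e / 2) + (c' + e / 2) by field.
rewrite (le_trans (ler_normD _ _))// lerD//; near: n.
  by apply: Fs; rewrite divr_gt0.
by apply: Gs; rewrite divr_gt0.
Unshelve. all: by end_near. Qed.

Lemma slope_cst (k : R) x : slope (fun=> k) x 0 0.
Proof.
by move=> e e0; near=> n; rewrite /diff_quot subrr mul0r subrr normr0 add0r ltW.
Unshelve. all: by end_near. Qed.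

Lemma slope_id x : slope id x 1 0.
Proof.
move=> e e0; near=> n; rewrite /diff_quot /= [x + _]addrC addrK mulVf ?pnatr_eq0//.
by rewrite subrr normr0 add0r ltW.
Unshelve. all: by end_near. Qed.

(** Chain rule with error: near [F x] the increment of [phi] is [phi'] times that of [F] up to a
    relative error [eta], and the quotients of [F] are bounded by [K], so only the error [c] of [F]
    survives, multiplied by [|phi'|]. *)
Lemma slope_comp {phi F x a c} : slope F x a c -> derivable phi (F x) 1 ->
  slope (fun y => phi (F y)) x (phi^`()%classic (F x) * a) (`|phi^`()%classic (F x)| * c).
Proof.
move=> Fs dphi e e0; pose d : R := phi^`()%classic (F x).
pose K : R := `|a| + `|c| + 1.
have K0 : 0 < K by rewrite ltr_wpDl// addr_ge0.
have Kge : \forall n \near \oo, `|diff_quot F x n| <= K.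
  have := slope_diff_quot_bound Fs; apply: filterS => n /le_trans; apply.
  by rewrite lerD2r lerD2l ler_norm.
have D0 : 0 < `|d| + 1 by rewrite ltr_wpDl.
pose eta := e / (2 * K).
have eta0 : 0 < eta by rewrite divr_gt0// mulr_gt0.
have hr : \forall h \near (0 : R), h != 0 ->
    `|d - h^-1 * (phi (h + F x) - phi (F x))| <= eta.
  have /cvgrPdist_le/(_ eta eta0) := dphi.
  rewrite near_withinE; apply: filterS => h + h0 => /(_ h0).
  rewrite /d /derive1 /= /GRing.scale/= mulr1.
  by under eq_fun do rewrite mulr1.
have Fh : F (x + n.+1%:R^-1) - F x @[n --> \oo] --> 0.
  by rewrite -(subrr (F x)); apply: cvgB; [exact: slope_shift Fs|exact: cvg_cst].
near=> n.
have Kn : `|diff_quot F x n| <= K by near: n.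
have hn : F (x + n.+1%:R^-1) - F x != 0 ->
    `|d - (F (x + n.+1%:R^-1) - F x)^-1 *
       (phi (F (x + n.+1%:R^-1) - F x + F x) - phi (F x))| <= eta.
  by near: n; exact: (Fh _ hr).
have H1 : `|diff_quot (fun y => phi (F y)) x n - d * diff_quot F x n| <= e / 2.
  have -> : e / 2 = eta * K by rewrite /eta; field; rewrite gt_eqF.
  (* The quotient of [phi] over the increment of [F] makes sense only if that increment is nonzero;
     otherwise both difference quotients vanish. *)
  have [h0|h0] := eqVneq (F (x + n.+1%:R^-1) - F x) 0.
    have := h0 => /eqP; rewrite subr_eq0 => /eqP FF.
    by rewrite /diff_quot FF !subrr !mul0r mulr0 subr0 normr0 mulr_ge0// ltW.
  have := hn h0; rewrite subrK => {}hn.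
  have -> : diff_quot (fun y => phi (F y)) x n - d * diff_quot F x n =
     - (d - (F (x + n.+1%:R^-1) - F x)^-1 *
       (phi (F (x + n.+1%:R^-1)) - phi (F x))) * diff_quot F x n.
    by rewrite /diff_quot; field.
  by rewrite normrM normrN ler_pM.
have H2 : `|diff_quot F x n - a| <= c + e / 2 / (`|d| + 1).
  by near: n; apply: Fs; rewrite !divr_gt0.
have -> : diff_quot (fun y => phi (F y)) x n - d * a =
   (diff_quot (fun y => phi (F y)) x n - d * diff_quot F x n) + d * (diff_quot F x n - a) by ring.
rewrite (le_trans (ler_normD _ _))// normrM.
have : `|d| * `|diff_quot F x n - a| <= `|d| * c + e / 2.
  rewrite (le_trans (ler_wpM2l _ H2))// mulrDr lerD2l.
  rewrite mulrCA ler_piMr ?divr_ge0 ?ltW//.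
  by rewrite ltr_pdivrMr// mul1r ltrDl.
by move: H1; lra.
Unshelve. all: by end_near. Qed.

Lemma slope_derivable {F} x : derivable F x 1 -> slope F x (F^`()%classic x) 0.
Proof.
move=> dF; have := slope_comp (slope_id x) dF.
by rewrite mulr1 mulr0.
Qed.

Lemma slopeM {F G x a c a' c'} : slope F x a c -> slope G x a' c' ->
  slope (fun y => F y * G y) x (a * G x + F x * a') (c * `|G x| + `|F x| * c').
Proof.
move=> Fs Gs e e0.
have aux (u v : R) : 0 <= u -> 0 <= v -> u / (v + 1) * v <= u.
  move=> u0 v0; rewrite mulrAC ler_pdivrMr ?ltr_wpDl//.
  by rewrite ler_wpM2l// lerDl.
have G1 : 0 < `|G x| + 1 by rewrite ltr_wpDl.
have F1 : 0 < `|F x| + 1 by rewrite ltr_wpDl.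
pose K : R := `|a| + `|c| + 1.
have K0 : 0 < K by rewrite ltr_wpDl// addr_ge0.
have Kge : \forall n \near \oo, `|diff_quot F x n| <= K.
  have := slope_diff_quot_bound Fs; apply: filterS => n /le_trans; apply.
  by rewrite lerD2r lerD2l ler_norm.
near=> n.
have Kn : `|diff_quot F x n| <= K by near: n.
have -> : diff_quot (fun y => F y * G y) x n - (a * G x + F x * a') =
  diff_quot F x n * (G (x + n.+1%:R^-1) - G x) + (diff_quot F x n - a) * G x +
   F x * (diff_quot G x n - a') by rewrite /diff_quot; ring.
have H1 : `|diff_quot F x n - a| <= c + e / 3 / (`|G x| + 1).
  by near: n; apply: Fs; rewrite !divr_gt0.
have H2 : `|diff_quot G x n - a'| <= c' + e / 3 / (`|F x| + 1).
  by near: n; apply: Gs; rewrite !divr_gt0.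
have H3 : `|G (x + n.+1%:R^-1) - G x| <= e / 3 / K.
  rewrite distrC; near: n; move: (slope_shift Gs) => /cvgrPdist_le; apply.
  by rewrite !divr_gt0.
have H4 : `|diff_quot F x n - a| * `|G x| <= c * `|G x| + e / 3.
  by rewrite (le_trans (ler_wpM2r _ H1))// mulrDl lerD2l aux// divr_ge0// ltW.
have H5 : `|F x| * `|diff_quot G x n - a'| <= `|F x| * c' + e / 3.
  rewrite (le_trans (ler_wpM2l _ H2))// mulrDr lerD2l mulrC.
  by rewrite aux// divr_ge0// ltW.
have H6 : `|diff_quot F x n| * `|G (x + n.+1%:R^-1) - G x| <= e / 3.
  rewrite (le_trans (ler_pM _ _ Kn H3))//.
  by rewrite mulrC divfK// gt_eqF.
rewrite (le_trans (ler_normD _ _))//.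
rewrite (le_trans (lerD (ler_normD _ _) (lexx _)))// (normrM (diff_quot F x n)) (normrM (_ - a)) (normrM (F x)).
by move: H4 H5 H6; lra.
Unshelve. all: by end_near. Qed.

End slope_calculus.

(** * Local Lipschitz continuity *)

Section local_lipschitz.
Context {R : realType}.
Implicit Types (F G phi : R -> R) (x : R).

(** Both points vary in the ball. A bound with one point fixed at [x] would not give, by
    compactness, a common bound on the difference quotients over a segment. *)
Definition lipschitz_near F x : Prop := exists C r : R, [/\ 0 <= C, 0 < r &
  forall y z, `|y - x| < r -> `|z - x| < r -> `|F y - F z| <= C * `|y - z|].

Lemma nbhs_dist_lt x (r : R) : 0 < r -> \forall y \near x, `|x - y| < r.
Proof. by move=> r0; apply/nbhs_ballP; exists r. Qed.

Lemma lipschitz_near_cont F x : lipschitz_near F x -> {for x, continuous F}.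
Proof.
move=> [C [r [C0 r0 CF]]]; apply/cvgrPdist_le => e e0.
have C1 : 0 < C + 1 by lra.
near=> y.
have yr : `|y - x| < r.
  by rewrite distrC; near: y; exact: nbhs_dist_lt.
rewrite (le_trans (CF _ _ _ _))// ?subrr ?normr0//.
have ye : `|x - y| <= e / (C + 1).
  by rewrite ltW//; near: y; apply: nbhs_dist_lt; rewrite divr_gt0.
rewrite (@le_trans _ _ ((C + 1) * `|x - y|))//.
  by rewrite ler_wpM2r// lerDl.
by rewrite mulrC -ler_pdivlMr.
Unshelve. all: by end_near. Qed.

Lemma lipschitz_near_cst (k : R) x : lipschitz_near (fun=> k) x.
Proof.
by exists 0, 1; split => // y z _ _; rewrite subrr normr0 mul0r.
Qed.

Lemma lipschitz_near_id x : lipschitz_near id x.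
Proof. by exists 1, 1; split => // y z _ _; rewrite mul1r. Qed.

Lemma lipschitz_near_comp phi F x : lipschitz_near F x -> lipschitz_near phi (F x) -> lipschitz_near (fun y => phi (F y)) x.
Proof.
move=> Fx [C' [r' [C'0 r'0 Cphi]]].
have [C [r [C0 r0 CF]]] := Fx.
have /cvgrPdist_lt/(_ _ r'0) := lipschitz_near_cont _ _ Fx.
move=> /nbhs_ballP[r2 /= r20 Fr2].
exists (C' * C), (Num.min r r2); split; first by rewrite mulr_ge0.
  by rewrite lt_min r0.
move=> y z; rewrite !lt_min => /andP[yr yr2] /andP[zr zr2].
rewrite (le_trans (Cphi _ _ _ _))//.
- by rewrite distrC; apply: Fr2; rewrite /ball/= distrC.
- by rewrite distrC; apply: Fr2; rewrite /ball/= distrC.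
- by rewrite -mulrA ler_wpM2l// CF.
Qed.

Lemma lipschitz_nearD F G x : lipschitz_near F x -> lipschitz_near G x -> lipschitz_near (fun y => F y + G y) x.
Proof.
move=> [C [r [C0 r0 CF]]] [C' [r' [C'0 r'0 CG]]].
exists (C + C'), (Num.min r r'); split; first by rewrite addr_ge0.
  by rewrite lt_min r0.
move=> y z; rewrite !lt_min => /andP[yr yr'] /andP[zr zr'].
have -> : F y + G y - (F z + G z) = (F y - F z) + (G y - G z) by ring.
by rewrite (le_trans (ler_normD _ _))// mulrDl lerD ?CF ?CG.
Qed.

Lemma lipschitz_nearM F G x : lipschitz_near F x -> lipschitz_near G x -> lipschitz_near (fun y => F y * G y) x.
Proof.
move=> Fx Gx.
have bnd H : lipschitz_near H x -> exists2 r : R, 0 < r &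
    forall y, `|y - x| < r -> `|H y| <= `|H x| + 1.
  move=> /lipschitz_near_cont/cvgrPdist_lt/(_ _ ltr01)/nbhs_ballP[r /= r0 Hr].
  exists r => // y yr; rewrite -[H y](subrK (H x)) addrC (le_trans (ler_normD _ _))//.
  by rewrite lerD2l distrC ltW//; apply: Hr; rewrite /ball/= distrC.
have [r1 r10 F1] := bnd F Fx; have [r2 r20 G2] := bnd G Gx.
have [C [r [C0 r0 CF]]] := Fx; have [C' [r' [C'0 r'0 CG]]] := Gx.
exists (C * (`|G x| + 1) + (`|F x| + 1) * C').
exists (Num.min (Num.min r r') (Num.min r1 r2)); split.
- by rewrite addr_ge0// mulr_ge0// addr_ge0.
- by rewrite !lt_min r0 r'0 r10.
move=> y z; rewrite !lt_min => /andP[/andP[yr yr'] /andP[yr1 yr2]].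
move=> /andP[/andP[zr zr'] /andP[zr1 zr2]].
have -> : F y * G y - F z * G z = (F y - F z) * G y + F z * (G y - G z) by ring.
rewrite (le_trans (ler_normD _ _))// [leRHS]mulrDl !normrM lerD//.
  by rewrite mulrAC ler_pM// ?CF ?G2.
by rewrite -mulrA ler_pM// ?CG ?F1.
Qed.

Lemma lipschitz_near_derivable F x (C r : R) : 0 < r ->
  (forall y, `|y - x| < r -> derivable F y 1 /\ `|F^`()%classic y| <= C) -> lipschitz_near F x.
Proof.
move=> r0 Fr.
have C0 : 0 <= C by rewrite (le_trans _ (Fr x _).2)// subrr normr0.
exists C, r; split => //.
have key y z : y <= z -> `|y - x| < r -> `|z - x| < r -> `|F y - F z| <= C * `|y - z|.
  move=> yz yr zr.
  have inr w : y <= w <= z -> `|w - x| < r.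
    move=> /andP[yw wz]; move: yr zr; rewrite !ltr_norml; lra.
  have [||w] := @MVT_segment R F (F^`()%classic) y z yz.
  - move=> w /[!in_itv]/= /andP[yw wz].
    have wr : `|w - x| < r by apply: inr; rewrite !ltW.
    by have [dF _] := Fr _ wr; apply: DeriveDef => //; rewrite derive1E.
  - apply: derivable_within_continuous => w /[!in_itv]/= yzw.
    exact: (Fr _ (inr _ yzw)).1.
  rewrite in_itv/= => yzw Fyz.
  rewrite distrC Fyz normrM (distrC y z) ler_wpM2r//.
  exact: (Fr _ (inr _ yzw)).2.
move=> y z yr zr; have [yz|zy] := leP y z; first exact: key.
by rewrite distrC (distrC y); apply: key => //; rewrite ltW.
Qed.

Lemma lipschitz_near_C1 F x : (\forall y  \near x, derivable F y 1) ->
  {for x, continuous F^`()%classic} -> lipschitz_near F x.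
Proof.
move=> dF /cvgrPdist_lt/(_ _ ltr01) cF.
have /nbhs_ballP[r /= r0 rF] : \forall y \near x, derivable F y 1 /\ `|F^`()%classic x - F^`()%classic y| < 1 by exact: filterI.
apply: (@lipschitz_near_derivable F x (`|F^`()%classic x| + 1) r) => // y yr.
have [|dFy Fy] := rF y; first by rewrite /ball/= distrC.
split => //; rewrite -[_ y](subrK (F^`()%classic x)) addrC.
by rewrite (le_trans (ler_normD _ _))// lerD2l distrC ltW.
Qed.

Lemma lipschitz_near_inv x : x != 0 -> lipschitz_near (fun y => y^-1) x.
Proof.
move=> x0; have x20 : 0 < `|x| / 2 by rewrite divr_gt0// normr_gt0.
exists ((`|x| / 2) ^- 2), (`|x| / 2); split; rewrite ?invr_ge0 ?exprn_ge0 ?ltW//.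
have key y : `|y - x| < `|x| / 2 -> `|x| / 2 < `|y|.
  move=> yx; have := ler_distD y x 0; rewrite !subr0 distrC.
  rewrite -subr_ge0 => h.
  move: (ler_normD (x - y) y); rewrite subrK (distrC x); lra.
move=> y z /key yx /key zx.
have y0 : y != 0 by rewrite -normr_gt0 (lt_trans _ yx).
have z0 : z != 0 by rewrite -normr_gt0 (lt_trans _ zx).
have -> : y^-1 - z^-1 = (z - y) * (y^-1 * z^-1) by field; rewrite y0 z0.
rewrite normrM mulrC distrC ler_wpM2r// normrM !normfV -exprVn expr2.
by rewrite ler_pM// ?invr_ge0// lef_pV2 ?posrE ?normr_gt0// ltW.
Qed.

Lemma lipschitz_near_expR x : lipschitz_near (@expR R) x.
Proof.
apply: lipschitz_near_C1; first by near=> y; exact: derivable_expR.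
have -> : (@expR R)^`()%classic = expR by apply/funext => z; rewrite derive1E derive_val.
exact: continuous_expR.
Unshelve. all: by end_near. Qed.

(** By compactness of [[a, b]]. The integer [N] does two things: it exceeds the local Lipschitz
    constants, and [n >= N] makes the step [1/(n+1)] small enough to stay in the local balls. The
    bound serves for dominated convergence in [ftc_le]. *)
Lemma lipschitz_near_uniform F (a b : R) : (forall x, a <= x <= b -> lipschitz_near F x) ->
  exists N : nat, forall x n, a <= x <= b -> (N <= n)%N -> `|diff_quot F x n| <= N%:R.
Proof.
move=> Fab.
have /compact_near_coveringP := @segment_compact R a b.
move=> /(_ nat \oo (fun N x => forall n, (N <= n)%N -> `|diff_quot F x n| <= N%:R) _).
case => [x|N _ /(_ N (leqnn N)) abN]; last first.
  exists N => x n xab Nn; apply: abN => //.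
rewrite set_itvcc => /=; move: x => x' ; move: (x' : R) => {x'} x /= xab.
have [C [r [C0 r0 CF]]] := Fab x xab.
have r20 : 0 < r / 2 by rewrite divr_gt0.
exists ([set y | `|x - y| < r / 2], [set N : nat | C <= N%:R /\ (r / 2)^-1 < N%:R]).
  split; first exact: nbhs_dist_lt.
  exists (maxn (Num.bound C) (Num.bound (r / 2)^-1)) => // n /=.
  rewrite geq_max => /andP[n1 n2]; split.
    by rewrite (le_trans (ltW (archi_boundP C0)))// ler_nat.
  rewrite (lt_le_trans (archi_boundP _))// ?ler_nat//.
  by rewrite invr_ge0 ltW.
move=> [y N] /= [xy [CN rN]] n Nn.
have n0 : 0 < n.+1%:R :> R by rewrite ltr0n.
have nr : n.+1%:R^-1 < r / 2.
  rewrite invf_plt ?posrE// (lt_le_trans rN)// ler_nat.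
  exact: leq_trans Nn _.
have n10 : 0 <= n.+1%:R^-1 :> R by rewrite invr_ge0 ltW.
rewrite /diff_quot normrM (ger0_norm (ltW n0)) -ler_pdivlMr//.
rewrite (le_trans (CF _ _ _ _))//.
- move: xy nr n10; rewrite !ltr_norml; move: (n.+1%:R^-1 : R) => h.
  by clear -r0 => /andP[? ?] ? ?; apply/andP; split; lra.
- by move: xy; rewrite !ltr_norml; lra.
- by rewrite addrAC subrr add0r ger0_norm// ler_wpM2r.
Qed.

End local_lipschitz.

(** * Integrating upper bounds on slopes *)

Section ftc_inequality.
Context {R : realType}.
Implicit Types (F G phi A B : R -> R) (a b x : R).
Local Notation leb := (@lebesgue_measure R).
Local Notation mfun D f := (@measurable_fun _ _ (measurableTypeR R) R D f).

Lemma mfun_EFinP (D : set R) F :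
  @measurable_fun _ _ (measurableTypeR R) (\bar R) D (EFin \o F) <-> mfun D F.
Proof. exact: (@measurable_EFinP _ (measurableTypeR R) R D F). Qed.

Lemma continuous_itv_integrable {F a b} :
  (forall x, a <= x <= b -> {for x, continuous F}) ->
  leb.-integrable `[a, b] (EFin \o F).
Proof.
move=> cF; apply: continuous_compact_integrable; first exact: segment_compact.
apply: continuous_in_subspaceT => x.
by rewrite inE/= in_itv/=; exact: cF.
Qed.

Lemma diff_quot_continuous F x n : {for x, continuous F} ->
  {for x + n.+1%:R^-1, continuous F} ->
  {for x, continuous (fun y => diff_quot F y n)}.
Proof.
move=> cFx cFy; rewrite /diff_quot.
apply: continuousM; last exact: cst_continuous.
apply: continuousB => //.
have := @continuous_comp R R R (fun y : R => y + n.+1%:R^-1) F x; apply => //.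
by apply: cvgD; [exact: cvg_id|exact: cvg_cst].
Qed.

Lemma invS_le1 n : 0 < n.+1%:R^-1 :> R /\ n.+1%:R^-1 <= 1 :> R.
Proof.
by split; rewrite ?invr_gt0 ?ltr0n// invf_le1 ?ltr0n// ler1n.
Qed.

(** If [P] is an antiderivative of [F], then [diff_quot P _ n] is one of [diff_quot F _ n]. The
    integral is thus a difference of quotients of [P], which tends to [F b - F a]. *)
Lemma integral_diff_quot F a b : a < b ->
  (forall x, a - 1 <= x <= b + 2 -> {for x, continuous F}) ->
  exists P : R -> R,
    (forall n, (\int[leb]_(x in `[a, b]) (diff_quot F x n)%:E)%E = (diff_quot P b n - diff_quot P a n)%:E) /\
    (slope P a (F a) 0 /\ slope P b (F b) 0).
Proof.
move=> ab cF.
have iF := continuous_itv_integrable cF.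
have [P dP] : exists P : R -> R, forall x, a - 1 < x -> x < b + 2 ->
    derivable P x 1 /\ P^`()%classic x = F x.
  (* Starting at [a - 1] makes [P] differentiable at [a] itself; the margin up to [b + 2] covers the
     points [x + 1/(n+1)], which may reach [b + 1]. *)
  exists (fun x => \int[leb]_(t in `[a - 1, x]) F t)%R => x ax xb.
  apply: (@continuous_FTC1_closed R F (a - 1) x (b + 2)) => //.
  by apply: cF; rewrite !ltW.
exists P; split; last first.
  have [dPa Pa] : derivable P a 1 /\ P^`()%classic a = F a by apply: dP; lra.
  have [dPb Pb] : derivable P b 1 /\ P^`()%classic b = F b by apply: dP; lra.
  have sa := slope_derivable a dPa; have sb := slope_derivable b dPb.
  by rewrite Pa in sa; rewrite Pb in sb; split; [exact: sa|exact: sb].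
move=> n; have [h0 h1] := invS_le1 n.
have isP x : a - 1 < x -> x < b + 2 -> is_derive x 1 P (F x).
  move=> ax xb; have [dPx Px] := dP x ax xb.
  by apply: DeriveDef => //; rewrite -derive1E.
have isdq x : a - 1 < x -> x < b + 1 -> is_derive x 1 (fun y => diff_quot P y n) (diff_quot F x n).
  move=> ax xb.
  have P1 : is_derive x 1 P (F x) by apply: isP => //; lra.
  have P2 : is_derive (x + n.+1%:R^-1) 1 P (F (x + n.+1%:R^-1)).
    by apply: isP; move: h0 h1; move: (n.+1%:R^-1 : R) => h h0 h1; lra.
  have P3 : is_derive x 1 (fun y => P (y + n.+1%:R^-1)) (F (x + n.+1%:R^-1)).
    have sh : is_derive x 1 (fun y : R => y + n.+1%:R^-1) 1.
      by apply: is_derive_eq; rewrite scaler0 addr0.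
    have := @is_derive1_comp R P (fun y : R => y + n.+1%:R^-1) x _ _ P2 sh.
    by rewrite mulr1.
  rewrite /diff_quot.
  apply: is_derive_eq; rewrite /GRing.scale/= /diff_quot; ring.
have cdq x : a <= x <= b -> {for x, continuous (fun y => diff_quot F y n)}.
  move=> axb; apply: diff_quot_continuous; apply: cF.
    by move: axb; lra.
  by move: axb h0 h1; move: (n.+1%:R^-1 : R) => h; lra.
have ddq x : a <= x <= b -> derivable (fun y => diff_quot P y n) x 1.
  by move=> axb; have [] // := isdq x; lra.
rewrite (@continuous_FTC2 R (fun x => diff_quot F x n) (fun x => diff_quot P x n) a b) ?EFinB//.
- by apply: continuous_in_subspaceT => x; rewrite inE/= in_itv/=; exact: cdq.
- split.
  + by move=> x; rewrite in_itv/= => /andP[ax xb]; apply: ddq; rewrite !ltW.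
  + have : derivable (fun y => diff_quot P y n) a 1 by apply: ddq; lra.
    move=> /derivable1_diffP/differentiable_continuous ca.
    exact: cvg_at_right_filter.
  + have : derivable (fun y => diff_quot P y n) b 1 by apply: ddq; lra.
    move=> /derivable1_diffP/differentiable_continuous ca.
    exact: cvg_at_left_filter.
- move=> x; rewrite in_itv/= => /andP[ax xb]; rewrite derive1E.
  by have [] // := isdq x; lra.
Qed.

Lemma slope_cvg F x a : slope F x a 0 -> diff_quot F x n @[n --> \oo] --> a.
Proof.
move=> Fa; apply/cvgrPdist_le => e e0; near=> n.
by rewrite distrC -[e]add0r; near: n; exact: Fa.
Unshelve. all: by end_near. Qed.

(** The means of [diff_quot F] converge to [F b - F a] while the positive part
  of [diff_quot F + A - B] is bounded and tends to [0]: no almost everywhere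
  differentiability theorem is needed. *)
Lemma ftc_le F A B a b : a < b ->
  (forall x, a - 1 <= x <= b + 2 -> lipschitz_near F x) ->
  (forall x, a <= x <= b -> {for x, continuous A}) ->
  mfun `[a, b] B -> (forall x, a <= x <= b -> 0 <= B x) ->
  (forall x, a <= x <= b ->
    exists al c, slope F x al c /\ al + c <= B x - A x) ->
  ((F b)%:E + \int[leb]_(x in `[a, b]) (A x)%:E <=
   (F a)%:E + \int[leb]_(x in `[a, b]) (B x)%:E)%E.
Proof.
move=> ab lF cA mB B0 FAB.
have mab : @measurable _ (measurableTypeR R) `[a, b] by exact: measurable_itv.
have inab x : `[a, b]%classic x -> a <= x <= b by rewrite /= in_itv.
have iA := continuous_itv_integrable cA.
have B0E x : `[a, b]%classic x -> (0 <= (B x)%:E)%E by move=> /inab xab; rewrite lee_fin B0.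
(* If [B] has infinite integral the right-hand side is [+oo]; from here on [B] is integrable and the
   computation takes place in the reals. *)
have [Boo|Bfin] := eqVneq (\int[leb]_(x in `[a, b]) (B x)%:E)%E +oo%E.
  by rewrite Boo addey ?leey.
have iB : leb.-integrable `[a, b] (EFin \o B).
  apply/integrableP; split; first exact/mfun_EFinP.
  have -> : (\int[leb]_(x in `[a, b]) `|(EFin \o B) x| =
      \int[leb]_(x in `[a, b]) (B x)%:E)%E; last by rewrite ltey.
  apply: eq_integral => x; rewrite inE => /inab xab /=.
  by rewrite ger0_norm// B0.
have [P [IP [Pa Pb]]] := @integral_diff_quot F a b ab (fun x xab => lipschitz_near_cont _ _ (lF x xab)).
have cdq x n : a <= x <= b -> {for x, continuous (fun y => diff_quot F y n)}.
  have [h0 h1] := invS_le1 n.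
  move=> xab; apply: diff_quot_continuous; apply: lipschitz_near_cont; apply: lF.
    by move: xab; lra.
  by move: xab h0 h1; move: (n.+1%:R^-1 : R) => h; lra.
have idq n := continuous_itv_integrable (fun x => @cdq x n).
have [N HN] : exists N : nat, forall x n, a <= x <= b -> (N <= n)%N -> `|diff_quot F x n| <= N%:R.
  by apply: lipschitz_near_uniform => x xab; apply: lF; lra.
have [MA HA] : exists MA : R, forall x, a <= x <= b -> A x <= MA.
  have [|c _ cmax] := @EVT_max R A a b (ltW ab).
    by apply: continuous_in_subspaceT => x; rewrite inE/= in_itv/=; exact: cA.
  by exists (A c) => x xab; apply: cmax; rewrite in_itv.
(* The index is shifted by [N] so that the uniform bound on the quotients holds for every [n]; as
   [B >= 0] and [A <= MA], this dominates [e n] by a constant. *)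
pose e n x := Num.max (diff_quot F x (n + N) + A x - B x) 0.
have me n : mfun `[a, b] (e n).
  apply: measurable_maxr => //.
  apply: measurable_funB => //; apply: measurable_funD => //.
    by apply/mfun_EFinP; exact: measurable_int (idq _).
  by apply/mfun_EFinP; exact: measurable_int iA.
have e0 n x : 0 <= e n x by rewrite /e le_max lexx orbT.
have ebnd n x : a <= x <= b -> e n x <= N%:R + `|MA|.
  move=> xab; rewrite /e ge_max addr_ge0// andbT.
  have := HN x (n + N)%N xab (leq_addl _ _); rewrite ler_norml => /andP[_ h1].
  have := HA x xab; have := B0 x xab; have := ler_norm MA; move: h1.
  move: (diff_quot F x (n + N)) => ?; lra.
have ie n : leb.-integrable `[a, b] (EFin \o e n).
  apply: (measurable_bounded_integrable mab _ (me n)).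
    by apply: compact_finite_measure; exact: segment_compact.
  exists (N%:R + `|MA|); split; first exact: num_real.
  move=> k hk x /= /inab xab; rewrite ger0_norm ?e0//.
  by rewrite (le_trans (ebnd _ _ xab))// ltW.
have ecvg x : a <= x <= b -> e n x @[n --> \oo] --> 0.
  move=> xab; have [al [c [Fs alc]]] := FAB x xab.
  apply/cvgrPdist_le => eta eta0; near=> n.
  rewrite sub0r normrN ger0_norm// /e ge_max (ltW eta0) andbT.
  have : `|diff_quot F x (n + N) - al| <= c + eta.
    near: n; have [k _ kP] := Fs _ eta0; exists k => // n /= kn.
    by apply: kP => /=; exact: leq_trans kn (leq_addr _ _).
  rewrite ler_norml => /andP[_]; move: alc; move: (diff_quot F x (n + N)) => ?; lra.
have intE G : leb.-integrable `[a, b] (EFin \o G) ->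
    (\int[leb]_(x in `[a, b]) (G x)%:E)%E = (\int[leb]_(x in `[a, b]) (G x))%:E.
  by move=> iG; rewrite /Rintegral fineK//; exact: integrable_fin_num iG.
have Ie : (\int[leb]_(x in `[a, b]) (e n x)) @[n --> \oo] --> (0 : R).
  have [|||||_ _] := @dominated_convergence _ (measurableTypeR R) R leb `[a, b]
     mab (fun n => EFin \o e n) (cst 0%E) (cst (N%:R + `|MA|)%:E).
  - by move=> n; exact/mfun_EFinP.
  - exact: measurable_cst.
  - by apply: aeW => x /inab xab; apply: cvg_EFin; [exact: nearW|exact: ecvg].
  - apply: continuous_itv_integrable => x _; exact: cst_continuous.
  - apply: aeW => x n /inab xab; rewrite /= lee_fin ger0_norm ?e0//.
    exact: ebnd.
  rewrite integral0 => /fine_cvg; apply: cvg_trans.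
  by apply: near_eq_cvg; near=> n.
rewrite !intE// -!EFinD lee_fin.
have main n : diff_quot P b (n + N) - diff_quot P a (n + N) + \int[leb]_(x in `[a, b]) (A x) <=
    \int[leb]_(x in `[a, b]) (B x) + \int[leb]_(x in `[a, b]) (e n x).
  have -> : diff_quot P b (n + N) - diff_quot P a (n + N) = \int[leb]_(x in `[a, b]) (diff_quot F x (n + N)).
    by rewrite /Rintegral IP.
  rewrite -!RintegralD//; apply: le_Rintegral => //.
  - exact: (integrableD mab (idq (n + N)%N) iA).
  - exact: (integrableD mab iB (ie n)).
  - by move=> x _; rewrite -lerBlDl /e le_max lexx.
have L1 : diff_quot P b (n + N) - diff_quot P a (n + N) + \int[leb]_(x in `[a, b]) (A x) @[n --> \oo] -->
    F b - F a + \int[leb]_(x in `[a, b]) (A x).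
  apply: cvgD; last exact: cvg_cst.
  apply: cvgB.
    by have /slope_cvg := Pb; rewrite -(cvg_shiftn N).
  by have /slope_cvg := Pa; rewrite -(cvg_shiftn N).
have L2 : \int[leb]_(x in `[a, b]) (B x) + \int[leb]_(x in `[a, b]) (e n x) @[n --> \oo] -->
    \int[leb]_(x in `[a, b]) (B x) + 0.
  by apply: cvgD => //; exact: cvg_cst.
have := ler_cvg_to L1 L2; rewrite addr0 => h.
by rewrite -lerBlDl addrAC; apply: h; apply: nearW.
Unshelve. all: by end_near. Qed.

End ftc_inequality.

(** The Radon-Nikodym derivative of [nu] has the same integral as [w] over every measurable set, so
    both agree almost everywhere, and the change of variables for that derivative carries over to
    [w]. *)
Lemma ge0_integral_density d (T : measurableType d) (R : realType)
    (nu : {finite_measure set T -> \bar R})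
    (mu : {sigma_finite_measure set T -> \bar R}) (w g : T -> R) (D : set T) :
  measurable_fun setT w -> (forall x, 0 <= w x) ->
  (forall A, measurable A -> nu A = \int[mu]_(x in A) (w x)%:E)%E ->
  measurable D -> measurable_fun D g -> (forall x, 0 <= g x) ->
  (\int[nu]_(x in D) (g x)%:E = \int[mu]_(x in D) (g x * w x)%:E)%E.
Proof.
move=> mw w0 nuw mD mg g0.
have mwE : measurable_fun setT (EFin \o w) by exact/measurable_EFinP.
have numu : nu `<< mu.
  move=> A /= nA B mB BA.
  rewrite nuw//; apply: null_set_integral => //; last exact: nA.
  exact: measurable_funTS.
have mgE : measurable_fun D (EFin \o g) by exact/measurable_EFinP.
have g0E x : (0 <= (g x)%:E)%E by rewrite lee_fin.
rewrite -(Radon_Nikodym_SigmaFinite.change_of_variables numu g0E mD mgE).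
have iRN := Radon_Nikodym_SigmaFinite.f_integrable numu.
have ae_w : ae_eq mu setT (Radon_Nikodym_SigmaFinite.f nu mu) (EFin \o w).
  apply: integral_ae_eq => // E _ mE.
  by rewrite -nuw// -Radon_Nikodym_SigmaFinite.f_integral.
apply: ae_eq_integral => //.
- apply: emeasurable_funM => //.
  exact: measurable_funTS (measurable_int _ iRN).
- apply/measurable_EFinP; apply: measurable_funM => //; exact: measurable_funTS.
- move: ae_w; apply: filterS => x /= /(_ I) -> _.
  by rewrite EFinM.
Qed.

(** * Integration of slopes along either half-line *)

Section oriented_ftc.
Context {R : realType}.
Implicit Types (F G phi A B : R -> R) (a b x s : R).
Local Notation leb := (@lebesgue_measure R).
Local Notation mfun D f := (@measurable_fun _ _ (measurableTypeR R) R D f).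

(** With [s = 1] or [s = -1] one proof covers the right and the left tail. *)
Definition oriented_itv s a b : set (measurableTypeR R) := [set x : R | a <= s * x <= b].

Lemma oriented_itv1 a b : oriented_itv 1 a b = `[a, b]%classic.
Proof. by apply/seteqP; split => x; rewrite /oriented_itv/= in_itv/= mul1r. Qed.

Lemma oriented_itvN1 a b : oriented_itv (-1) a b = `[- b, - a]%classic.
Proof.
apply/seteqP; split => x; rewrite /oriented_itv/= in_itv/= mulN1r.
  by rewrite lerNr andbC [- b <= x]lerNl.
by rewrite lerNr andbC [- b <= x]lerNl.
Qed.

Lemma measurable_oriented_itv s a b : s = 1 \/ s = -1 -> measurable (oriented_itv s a b).
Proof. by case=> ->; rewrite ?oriented_itv1 ?oriented_itvN1; exact: measurable_itv. Qed.

(** Reversing the direction changes the sign of [al] but not of the error [c], which bounds an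
    absolute value; hence the combination [s * al + c]. *)
Lemma ftc_le_oriented s F A B a b : s = 1 \/ s = -1 -> a <= b ->
  (forall x, a - 2 <= s * x <= b + 2 -> lipschitz_near F x) ->
  (forall x, a <= s * x <= b -> {for x, continuous A}) ->
  mfun (oriented_itv s a b) B -> (forall x, a <= s * x <= b -> 0 <= B x) ->
  (forall x, a <= s * x <= b ->
    exists al c, slope F x al c /\ s * al + c <= B x - A x) ->
  ((F (s * b))%:E + \int[leb]_(x in oriented_itv s a b) (A x)%:E <=
   (F (s * a))%:E + \int[leb]_(x in oriented_itv s a b) (B x)%:E)%E.
Proof.
move=> s1; rewrite le_eqVlt => /orP[/eqP <- _ _ _ _ _|ab].
  have -> : oriented_itv s a a = `[s * a, s * a]%classic.
    rewrite set_itv1; apply/seteqP; split => x; rewrite /oriented_itv/=.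
      rewrite -eq_le => /eqP ->; case: s1 => ->; ring.
    by move=> ->; case: s1 => ->; rewrite ?mul1r ?mulN1r ?opprK lexx.
  by rewrite set_itv1 !integral_set1.
case: s1 => ->.
  rewrite oriented_itv1 !mul1r => lF cA mB B0 FAB; apply: ftc_le => //.
  - by move=> x xab; apply: lF; rewrite mul1r; lra.
  - by move=> x xab; apply: cA; rewrite mul1r.
  - by move=> x xab; apply: B0; rewrite mul1r.
  - by move=> x xab; have := FAB x; rewrite mul1r; setoid_rewrite mul1r; apply.
rewrite oriented_itvN1 !mulN1r => lF cA mB B0 FAB.
have ineg x : - b <= x <= - a -> a <= -1 * x <= b by lra.
have Nab : - b < - a by rewrite ltrN2.
(* For [s = -1] the lemma [ftc_le] is applied to [- F] on [[-b, -a]]; adding [F (- a) + F (- b)] to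
   both sides restores the claim. *)
have H : ((- F (- a))%:E + \int[leb]_(x in `[(- b)%R, (- a)%R]) (A x)%:E <=
   (- F (- b))%:E + \int[leb]_(x in `[(- b)%R, (- a)%R]) (B x)%:E)%E; last first.
  have := leeD2l (F (- a) + F (- b))%:E H; rewrite !addeA -!EFinD.
  by rewrite (_ : F (- a) + F (- b) + - F (- a) = F (- b)) 1?(_ : F (- a) + F (- b) + - F (- b) = F (- a))//; ring.
apply: (@ftc_le R (fun x => - F x) A B (- b) (- a) Nab).
- move=> x xab; have -> : (fun x => - F x) = (fun x => (fun=> -1) x * F x).
    by apply/funext => y; rewrite mulN1r.
  by apply: lipschitz_nearM; [exact: lipschitz_near_cst|apply: lF; lra].
- by move=> x xab; apply: cA; exact: ineg.
- exact: mB.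
- by move=> x xab; apply: B0; exact: ineg.
- move=> x xab; have [al [c [Fs alc]]] := FAB x (ineg x xab).
  by exists (- al), c; split; [exact: slopeN|rewrite mulN1r in alc].
Qed.

End oriented_ftc.

(** * Young functions between [x^2] and [x^theta] *)

Record young_growth {R : realType} (Phi : R -> R) (theta : R) : Prop := YoungGrowth {
  young_nice : nice_young Phi ;
  young_derivable : forall x : R, derivable Phi x 1 ;
  young_ge2 : {in `]0, +oo[ &, {homo (fun x => Phi x / x ^+ 2) : x y / x <= y}} ;
  young_gt2 : 2 < theta ;
  young_letheta : {in `]0, +oo[ &,
    {homo (fun x => Phi x / x `^ theta) : x y / x <= y >-> y <= x}} }.

Arguments young_nice {R Phi theta}.
Arguments young_derivable {R Phi theta}.
Arguments young_ge2 {R Phi theta}.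
Arguments young_gt2 {R Phi theta}.
Arguments young_letheta {R Phi theta}.

Section young_functions.
Context {R : realType} {Phi : R -> R} {theta : R} (Phg : young_growth Phi theta).
Let Phi_nice := young_nice Phg.
Let Phi_diff := young_derivable Phg.
Let Phi_ge2 := young_ge2 Phg.
Let theta_gt2 := young_gt2 Phg.
Let Phi_letheta := young_letheta Phg.
Implicit Types (x y z l b : R).

Lemma theta_gt0 : 0 < theta. Proof. exact: lt_trans theta_gt2. Qed.

Lemma young0 : Phi 0 = 0. Proof. by case: Phi_nice. Qed.

Lemma young_ge0 x : 0 <= Phi x. Proof. by case: Phi_nice. Qed.

Lemma young_abs x : Phi `|x| = Phi x.
Proof.
by have [x0|x0] := leP 0 x; [rewrite ger0_norm|rewrite ltr0_norm// nice_young_even].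
Qed.

Lemma young_gt0 x : 0 < x -> 0 < Phi x.
Proof.
move=> x0; rewrite lt_neqAle young_ge0 andbT; apply/eqP => /esym /(nice_young_eq0 Phi_nice).
by move=> xE; rewrite xE ltxx in x0.
Qed.

Lemma young_ratio2 x y : 0 < x -> x <= y -> Phi x * y ^+ 2 <= Phi y * x ^+ 2.
Proof.
move=> x0 xy; have y0 := lt_le_trans x0 xy.
have := Phi_ge2 x y; rewrite !in_itv/= !andbT x0 y0 => /(_ isT isT xy).
by rewrite ler_pdivrMr ?exprn_gt0// mulrAC ler_pdivlMr ?exprn_gt0.
Qed.

Lemma young_ratiotheta x y : 0 < x -> x <= y ->
  Phi y <= Phi x / x `^ theta * y `^ theta.
Proof.
move=> x0 xy; have y0 := lt_le_trans x0 xy.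
have := Phi_letheta x y; rewrite !in_itv/= !andbT x0 y0 => /(_ isT isT xy).
by rewrite ler_pdivrMr ?powR_gt0.
Qed.

Lemma young_scale_le1 l x : 0 <= l -> l <= 1 -> 0 <= x -> Phi (l * x) <= l ^+ 2 * Phi x.
Proof.
rewrite le_eqVlt => /orP[/eqP <-|l0] l1.
  by move=> _; rewrite mul0r young0 expr0n mul0r.
rewrite le_eqVlt => /orP[/eqP <-|x0]; first by rewrite mulr0 young0 mulr0.
have lx0 : 0 < l * x by rewrite mulr_gt0.
have := @young_ratio2 (l * x) x lx0; rewrite ler_piMl ?(ltW x0)// => /(_ isT).
by rewrite exprMn (mulrA (Phi x)) ler_pM2r ?exprn_gt0// [leRHS]mulrC.
Qed.

Lemma young_scale_ge1 l x : 1 <= l -> 0 <= x -> Phi (l * x) <= l `^ theta * Phi x.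
Proof.
move=> l1; rewrite le_eqVlt => /orP[/eqP <-|x0]; first by rewrite mulr0 young0 mulr0.
have := @young_ratiotheta x (l * x) x0; rewrite ler_peMl ?(ltW x0)// => /(_ isT).
rewrite powRM ?(ltW x0)//; last by rewrite (le_trans ler01).
by rewrite mulrCA -mulrA mulVf ?mulr1// gt_eqF// powR_gt0.
Qed.

Lemma young_mono x y : 0 <= x -> x <= y -> Phi x <= Phi y.
Proof.
rewrite le_eqVlt => /orP[/eqP <- _|x0 xy]; first by rewrite young0 young_ge0.
have y0 := lt_le_trans x0 xy.
have := young_ratio2 x y x0 xy; rewrite -ler_pdivlMr ?exprn_gt0// => /le_trans; apply.
rewrite ler_pdivrMr ?exprn_gt0// ler_wpM2l ?young_ge0// ler_pXn2r// nnegrE ltW//.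
Qed.

Lemma young_div_mono x y : 0 <= x -> x <= y -> Phi x / x <= Phi y / y.
Proof.
rewrite le_eqVlt => /orP[/eqP <- y0|x0 xy].
  by rewrite invr0 mulr0 divr_ge0// young_ge0.
have y0 := lt_le_trans x0 xy.
have := young_ratio2 x y x0 xy; rewrite -ler_pdivlMr ?exprn_gt0// => h.
rewrite ler_pdivrMr// (le_trans h)//.
rewrite ler_pdivrMr ?exprn_gt0//.
have -> : Phi y / y * x * y ^+ 2 = Phi y * (x * y) by field; rewrite gt_eqF.
by rewrite ler_wpM2l ?young_ge0// expr2 ler_pM2l.
Qed.

(** As [Phi(x)/x] is non-decreasing, [Phi(x + h) - Phi(x) >= h Phi(x)/x]; divide by [h] and pass to
    the limit. *)
Lemma young_derive_ge x : 0 <= x -> Phi x <= x * Phi^`()%classic x.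
Proof.
rewrite le_eqVlt => /orP[/eqP <-|x0]; first by rewrite young0 mul0r.
rewrite -ler_pdivrMl// mulrC.
have /slope_cvg cPhi := slope_derivable x (Phi_diff x).
apply: (ler_cvg_to (cvg_cst _) cPhi); near=> n.
have h0 : 0 < n.+1%:R^-1 :> R by rewrite invr_gt0.
rewrite /diff_quot -[X in _ <= _ * X]invrK ler_pdivlMr//.
move: h0; move: (n.+1%:R^-1 : R) => h h0.
have xh : x <= x + h by rewrite lerDl ltW.
have := young_div_mono x (x + h) (ltW x0) xh.
rewrite [leRHS]/(_ / _) ler_pdivlMr ?addr_gt0// mulrDr divfK ?gt_eqF//.
by rewrite -lerBrDl.
Unshelve. all: by end_near. Qed.

(** To the right of [x] the power function [y -> Phi(x) (y/x)^theta] lies above [Phi], and it meets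
    [Phi] at [x]; its derivative there is [theta Phi(x)/x]. At [x = 0] the right-hand side is [0] by
    the convention on inverses, in accordance with [Phi'(0) = 0]. *)
Lemma young_derive_le x : 0 <= x -> Phi^`()%classic x <= theta * (Phi x / x).
Proof.
rewrite le_eqVlt => /orP[/eqP <-|x0].
  rewrite invr0 !mulr0; have := nice_young_derive0 Phi_nice => -[_].
  by rewrite derive1E => ->.
have G : is_derive x 1 (fun y => Phi x / x `^ theta * y `^ theta) (theta * (Phi x / x)).
  have dp := is_derive1_powR theta x0.
  apply: is_derive_eq.
  rewrite /GRing.scale/= -[x `^ theta](@mulr_powRB1 _ x)//; [|exact: ltW|exact: theta_gt0].
  have p0 : x `^ (theta - 1) != 0 by rewrite gt_eqF// powR_gt0.
  by field; rewrite p0 gt_eqF.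
have dG : derivable (fun y => Phi x / x `^ theta * y `^ theta) x 1 by [].
have /slope_cvg cPhi := slope_derivable x (Phi_diff x).
have /slope_cvg cG := slope_derivable x dG.
rewrite derive1E derive_val in cG.
apply: (ler_cvg_to cPhi cG); near=> n.
rewrite /diff_quot ler_pM2r ?ltr0n// lerB//.
  by apply: young_ratiotheta => //; rewrite lerDl invr_ge0.
by rewrite divfK// gt_eqF// powR_gt0.
Unshelve. all: by end_near. Qed.

Lemma young_derive_ge0 x : 0 <= x -> 0 <= Phi^`()%classic x.
Proof.
rewrite le_eqVlt => /orP[/eqP <-|x0].
  have := nice_young_derive0 Phi_nice => -[_].
  by rewrite derive1E => ->.
by rewrite -(pmulr_rge0 _ x0) (le_trans (young_ge0 x))// young_derive_ge// ltW.
Qed.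

(** On [[0, r]] the derivative is at most [theta Phi(r)/r], by [young_derive_le] and the
    monotonicity of [Phi(x)/x]; evenness extends the bound to negative arguments. *)
Lemma young_lipschitz_near x : lipschitz_near Phi x.
Proof.
pose r := `|x| + 1; have r0 : 0 < r by rewrite ltr_wpDl.
pose C := theta * (Phi r / r).
have C0 : 0 <= C by rewrite mulr_ge0 ?divr_ge0 ?young_ge0// ltW ?theta_gt0.
have key y z : 0 <= y -> y <= z -> z < r -> `|Phi y - Phi z| <= C * `|y - z|.
  move=> y0 yz zr.
  have [||w] := @MVT_segment R Phi (Phi^`()%classic) y z yz.
  - by move=> w _; apply: DeriveDef => //; rewrite derive1E.
  - by apply: derivable_within_continuous => w _.
  rewrite in_itv/= => /andP[yw wz] Fyz.
  have w0 := le_trans y0 yw.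
  rewrite distrC Fyz normrM (distrC y z) ler_wpM2r//.
  rewrite ger0_norm ?young_derive_ge0// (le_trans (young_derive_le _ w0))//.
  rewrite ler_wpM2l//; first by rewrite ltW ?theta_gt0.
  by apply: young_div_mono => //; rewrite (le_trans wz)// ltW.
have key2 y z : 0 <= y -> y < r -> 0 <= z -> z < r -> `|Phi y - Phi z| <= C * `|y - z|.
  move=> y0 yr z0 zr; have [yz|/ltW zy] := leP y z; first exact: key.
  by rewrite distrC (distrC y); exact: key.
have nr y : `|y - x| < 1 -> `|y| < r.
  move=> yx; rewrite -[y](subrK x) (le_lt_trans (ler_normD _ _))//.
  by rewrite /r addrC ltrD2l.
exists C, 1; split => // y z yx zx.
rewrite -(young_abs y) -(young_abs z) (le_trans (key2 _ _ _ _ _ _))// ?nr//.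
by rewrite ler_wpM2l// ler_dist_dist.
Qed.

Local Notation H := (modification Phi).

(** For [|t| > 1] this is the monotonicity of [Phi(x)/x^2] between [1] and [|t|]. It makes the
    modified energy dominate the quadratic one, which is all that the Poincare part uses. *)
Lemma modification_sqr t : t ^+ 2 <= H t.
Proof.
rewrite /modification; case: ifPn => [//|]; rewrite -ltNge => t1.
have := young_ratio2 1 `|t| ltr01 (ltW t1); rewrite expr1n mulr1 real_normK ?num_real//.
by rewrite ler_pdivlMr ?young_gt0// mulrC.
Qed.

Lemma modification_ge0 t : 0 <= H t.
Proof. by rewrite (le_trans _ (modification_sqr t))// sqr_ge0. Qed.

Lemma young_le_modification t : 0 <= t -> Phi t <= Phi 1 * H t.
Proof.
move=> t0; rewrite /modification; case: ifPn => [|_]; rewrite ger0_norm//.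
  by move=> t1; have := young_scale_le1 t 1 t0 t1 ler01; rewrite mulr1 mulrC.
by rewrite mulrC divfK// gt_eqF// young_gt0.
Qed.

Lemma modification_mono s t : `|s| <= `|t| -> H s <= H t.
Proof.
move=> st; rewrite {1}/modification; case: ifPn => [s1|].
  rewrite (le_trans _ (modification_sqr t))//.
  by rewrite -(real_normK (num_real s)) -(real_normK (num_real t)) ler_pXn2r// nnegrE.
rewrite -ltNge => s1; rewrite /modification ifF; last first.
  by apply/negbTE; rewrite -ltNge (lt_le_trans s1).
by rewrite ler_pM2r ?invr_gt0 ?young_gt0// young_mono.
Qed.

(** If [l b <= z] the factor [b <= eps z] is absorbed, otherwise [z < l b] and
  the growth in [x^theta] bounds [Phi (l b)]. *)
Lemma young_absorb (eps : R) : 0 < eps -> exists2 C : R, 0 <= C &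
  forall z b, 0 <= z -> 0 <= b -> Phi z / z * b <= eps * Phi z + C * H b.
Proof.
move=> eps0; pose l : R := Num.max 1 eps^-1.
have l1 : 1 <= l by rewrite le_max lexx.
have l0 : 0 < l by rewrite (lt_le_trans ltr01).
have p0 := young_ge0 1.
exists (l `^ theta * Phi 1) => [|z b z0 b0]; first by rewrite mulr_ge0// powR_ge0.
have [zb|bz] := leP (l * b) z; last first.
  have b1 : 0 < b.
    by rewrite -(pmulr_rgt0 _ l0) (le_lt_trans z0).
  rewrite (@le_trans _ _ (l `^ theta * Phi 1 * H b))//; last first.
    by rewrite lerDr mulr_ge0 ?young_ge0// ltW.
  rewrite (@le_trans _ _ (Phi (l * b) / (l * b) * b))//.
    by rewrite ler_wpM2r// young_div_mono// ltW.
  have -> : Phi (l * b) / (l * b) * b = Phi (l * b) / l.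
    by field; rewrite !gt_eqF.
  rewrite (@le_trans _ _ (Phi (l * b)))//.
    by rewrite ler_pdivrMr// ler_peMr ?young_ge0.
  rewrite (le_trans (young_scale_ge1 _ _ l1 b0))// -mulrA ler_wpM2l ?powR_ge0//.
  exact: young_le_modification.
rewrite (@le_trans _ _ (eps * Phi z))//; last first.
  by rewrite lerDl mulr_ge0 ?modification_ge0// mulr_ge0// powR_ge0.
have [->|zn0] := eqVneq z 0; first by rewrite young0 mul0r mul0r mulr0.
have zp : 0 < z by rewrite lt_neqAle eq_sym zn0.
have bz : b <= eps * z.
  rewrite -ler_pdivrMl// (le_trans _ zb)// ler_wpM2r//.
  by rewrite le_max lexx orbT.
rewrite (@le_trans _ _ (Phi z / z * (eps * z)))//.
  by rewrite ler_wpM2l// divr_ge0// young_ge0.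
by rewrite mulrCA divfK.
Qed.

Lemma measurable_modification d (T : measurableType d) (g : T -> R) :
  measurable_fun setT g -> measurable_fun setT (fun t => H (g t)).
Proof.
move=> mg; rewrite /modification.
have mH : measurable_fun setT (fun t : R => if `|t| <= 1 then t ^+ 2 else Phi `|t| / Phi 1).
  apply: measurable_fun_ifT => //=.
  - by apply: measurable_fun_ler => //; exact: measurableT_comp.
  - under eq_fun do rewrite young_abs.
    apply: measurable_funM => //; apply: continuous_measurable_fun => x.
    exact: lipschitz_near_cont (young_lipschitz_near x).
exact: measurableT_comp mH mg.
Qed.

End young_functions.

(** * Weighted estimates *)

Section weighted_estimates.
Context {R : realType}.
Implicit Types (F G phi A B V W h T e : R -> R) (a b c k x s : R).
Local Notation leb := (@lebesgue_measure R).
Local Notation mfun D f := (@measurable_fun _ _ (measurableTypeR R) R D f).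

Lemma slope_eq {F x a c a' c'} : slope F x a c -> a = a' -> c = c' -> slope F x a' c'.
Proof. by move=> + <- <-. Qed.

Lemma slope_expR W x : derivable W x 1 ->
  slope (fun y => expR (W y)) x (expR (W x) * W^`()%classic x) 0.
Proof.
have dexp : derivable (@expR R) (W x) 1 by exact: derivable_expR.
move=> dW; apply: (slope_eq (slope_comp (slope_derivable x dW) dexp)).
  by rewrite derive1E derive_val.
by rewrite mulr0.
Qed.

Lemma slope_expRN W x : derivable W x 1 ->
  slope (fun y => expR (- W y)) x (- (expR (- W x) * W^`()%classic x)) 0.
Proof.
have dexp : derivable (@expR R) (- W x) 1 by exact: derivable_expR.
move=> dW; apply: (slope_eq (slope_comp (slopeN (slope_derivable x dW)) dexp)).
  by rewrite derive1E derive_val mulrN.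
by rewrite mulr0.
Qed.

Lemma slope_inv F x a c : slope F x a c -> F x != 0 ->
  slope (fun y => (F y)^-1) x (- (F x) ^- 2 * a) ((F x) ^- 2 * c).
Proof.
move=> Fs F0.
have did : derivable (@id R) (F x) 1 by [].
have dinv : derivable (fun y : R => y^-1) (F x) 1 := derivableV F0 did.
have invE : (fun y : R => y^-1)^`()%classic (F x) = - (F x) ^- 2.
  by rewrite derive1E (@deriveV _ _ (@id R) (F x) 1 F0 did) derive_id scaler1.
apply: (slope_eq (slope_comp Fs dinv)); rewrite invE//.
by rewrite normrN ger0_norm// invr_ge0 sqr_ge0.
Qed.

Lemma lipschitz_near_expRN W x : lipschitz_near W x -> lipschitz_near (fun y => expR (- W y)) x.
Proof.
move=> lW; apply: (@lipschitz_near_comp R (@expR R) (fun y => - W y)); last exact: lipschitz_near_expR.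
have -> : (fun y => - W y) = (fun y => (fun=> -1) y * W y).
  by apply/funext => y; rewrite mulN1r.
by apply: lipschitz_nearM => //; exact: lipschitz_near_cst.
Qed.

Lemma mfun_oriented_itv s a b F : s = 1 \/ s = -1 ->
  (forall x, a <= s * x <= b -> {for x, continuous F}) -> mfun (oriented_itv s a b) F.
Proof.
case=> -> cF; apply/mfun_EFinP.
- rewrite oriented_itv1; apply: measurable_int; apply: continuous_itv_integrable => x xab.
  by apply: cF; rewrite mul1r.
- rewrite oriented_itvN1; apply: measurable_int; apply: continuous_itv_integrable => x xab.
  by apply: cF; rewrite mulN1r lerNr andbC lerNl.
Qed.

(** Integrate the slope of [(h - k)^2 e^-W]: the weight contributes at most [-c (h - k)^2], the
    function at most [2 T |h - k|], and half of the gain absorbs the latter. Both boundary terms are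
    kept: the one at [b] is what [interior_osc] extracts, the one at [a] is fed by [interior_osc] in
    the tails. *)
Lemma weighted_poincare s a b c k W h T e : s = 1 \/ s = -1 -> a <= b -> 0 < c ->
  (forall x, a - 2 <= s * x <= b + 2 -> lipschitz_near W x) ->
  (forall x, a <= s * x <= b -> derivable W x 1 /\ c <= s * W^`()%classic x) ->
  (forall x, lipschitz_near h x) -> (forall x, slope h x 0 (T x)) ->
  (forall x, 0 <= T x) -> (forall x, T x ^+ 2 <= e x) -> mfun setT e ->
  (((h (s * b) - k) ^+ 2 * expR (- W (s * b)))%:E +
   \int[leb]_(x in oriented_itv s a b) (c / 2 * (h x - k) ^+ 2 * expR (- W x))%:E <=
   ((h (s * a) - k) ^+ 2 * expR (- W (s * a)))%:E +
   \int[leb]_(x in oriented_itv s a b) (2 / c * e x * expR (- W x))%:E)%E.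
Proof.
move=> s1 ab c0 lW dW lh hT T0 Te me.
have lhk x : lipschitz_near (fun y => h y - k) x by apply: lipschitz_nearD => //; exact: lipschitz_near_cst.
have lh2 x : lipschitz_near (fun y => (h y - k) ^+ 2) x by apply: lipschitz_nearM.
have e0 x : 0 <= e x by rewrite (le_trans _ (Te x))// sqr_ge0.
apply: (@ftc_le_oriented R s (fun x => (h x - k) ^+ 2 * expR (- W x))) => //.
- by move=> x xab; apply: lipschitz_nearM; [exact: lh2|apply: lipschitz_near_expRN; exact: lW].
- move=> x xab; apply: lipschitz_near_cont; apply: lipschitz_nearM.
    by apply: lipschitz_nearM => //; exact: lipschitz_near_cst.
  by apply: lipschitz_near_expRN; apply: lW; lra.
- apply: measurable_funM.
    by apply: measurable_funM => //; exact: measurable_funTS.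
  apply: mfun_oriented_itv => // x xab; apply: lipschitz_near_cont; apply: lipschitz_near_expRN; apply: lW; lra.
- by move=> x _; rewrite !mulr_ge0// ?expR_ge0// invr_ge0 ltW.
move=> x xab; have [dWx cW] := dW x xab.
have sl1 := slopeD (hT x) (slope_cst (- k) x).
have sl2 := @slope_eq _ x _ _ 0 (2 * (T x * `|h x - k|)) (slopeM sl1 sl1) _ _.
do 2 eexists; split.
  exact: (slopeM (sl2 ltac:(ring) ltac:(ring)) (slope_expRN W x dWx)).
have := expR_gt0 (- W x); move: (expR (- W x)) => E E0.
rewrite [`|E|]gtr0_norm//.
have -> : 2 / c * e x * E - c / 2 * (h x - k) ^+ 2 * E =
  E * (2 / c * e x - c / 2 * (h x - k) ^+ 2) by ring.
set g := h x - k; set D := W^`()%classic x.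
have -> : s * (0 * E + g * g * - (E * D)) + (2 * (T x * `|g|) * E + `|g * g| * 0) =
  E * (2 * (T x * `|g|) - s * D * g ^+ 2) by ring.
rewrite ler_pM2l//.
have amgm : 2 * (T x * `|g|) <= 2 / c * T x ^+ 2 + c / 2 * g ^+ 2.
  rewrite -subr_ge0 -(real_normK (num_real g)).
  have -> : 2 / c * T x ^+ 2 + c / 2 * `|g| ^+ 2 - 2 * (T x * `|g|) =
    2 / c * (T x - c / 2 * `|g|) ^+ 2 by field; rewrite gt_eqF.
  by rewrite mulr_ge0 ?sqr_ge0// divr_ge0// ltW.
have h1 : 2 / c * T x ^+ 2 <= 2 / c * e x by rewrite ler_wpM2l ?divr_ge0// ltW.
have h2 : c * g ^+ 2 <= s * D * g ^+ 2 by rewrite ler_wpM2r ?sqr_ge0.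
have -> : c / 2 = c - c / 2 by field.
by move: amgm h1 h2; rewrite mulrBl; lra.
Qed.

(** The function integrated is [h - e^V / c]. Since [s V' >= c], the subtracted term decreases at
    rate at least [e^V], which pays for the [e^V / 2] in [T <= (T^2 e^-V + e^V) / 2]. *)
Lemma exp_growth s a b c V h T e : s = 1 \/ s = -1 -> a <= b -> 0 < c ->
  (forall x, a - 2 <= s * x <= b + 2 -> lipschitz_near V x) ->
  (forall x, a <= s * x <= b -> derivable V x 1 /\ c <= s * V^`()%classic x) ->
  (forall x, lipschitz_near h x) -> (forall x, slope h x 0 (T x)) ->
  (forall x, 0 <= T x) -> (forall x, T x ^+ 2 <= e x) -> mfun setT e ->
  ((h (s * b))%:E <= (h (s * a) + c^-1 * expR (V (s * b)))%:E +
   \int[leb]_(x in oriented_itv s a b) (2^-1 * e x * expR (- V x))%:E)%E.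
Proof.
move=> s1 ab c0 lV dV lh hT T0 Te me.
have e0 x : 0 <= e x by rewrite (le_trans _ (Te x))// sqr_ge0.
have lF x : lipschitz_near V x -> lipschitz_near (fun y => h y + - c^-1 * expR (V y)) x.
  move=> lVx; apply: lipschitz_nearD => //; apply: lipschitz_nearM; first exact: lipschitz_near_cst.
  by apply: (@lipschitz_near_comp R (@expR R) V) => //; exact: lipschitz_near_expR.
have H : ((h (s * b) + - c^-1 * expR (V (s * b)))%:E +
    \int[leb]_(x in oriented_itv s a b) ((fun=> 0) x)%:E <=
   (h (s * a) + - c^-1 * expR (V (s * a)))%:E +
   \int[leb]_(x in oriented_itv s a b) (2^-1 * e x * expR (- V x))%:E)%E; last first.
  move: H; rewrite integral0 adde0 => H.
  have := leeD2l (c^-1 * expR (V (s * b)))%:E H; rewrite addeA -!EFinD => H2.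
  rewrite (_ : h (s * b) = c^-1 * expR (V (s * b)) + (h (s * b) - c^-1 * expR (V (s * b)))); last by ring.
  rewrite mulNr in H2; rewrite (le_trans H2)// leeD2r// lee_fin.
  have : 0 <= c^-1 * expR (V (s * a)) by rewrite mulr_ge0 ?expR_ge0// invr_ge0 ltW.
  rewrite mulNr; move: (expR _) => ?; move: (expR _) => ?; lra.
apply: (@ftc_le_oriented R s (fun y => h y + - c^-1 * expR (V y)) (fun=> 0)
  (fun x => 2^-1 * e x * expR (- V x)) a b s1 ab).
- by move=> x xab; apply: lF; exact: lV.
- by move=> x _; exact: cst_continuous.
- apply: measurable_funM.
    by apply: measurable_funM => //; exact: measurable_funTS.
  apply: mfun_oriented_itv => // x xab; apply: lipschitz_near_cont; apply: lipschitz_near_expRN; apply: lV; lra.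
- by move=> x _; rewrite !mulr_ge0// ?expR_ge0.
move=> x xab; have [dVx cV] := dV x xab.
do 2 eexists; split.
  exact: (slopeD (hT x) (slopeM (slope_cst (- c^-1) x) (slope_expR V x dVx))).
rewrite expRN; have := expR_gt0 (V x); move: (expR (V x)) => E E0.
set D := V^`()%classic x.
rewrite subr0 mul0r !add0r !mulr0 mul0r addr0.
have -> : s * (- c^-1 * (E * D)) + (T x + 0) = T x - c^-1 * (s * D) * E + 0 by ring.
have h1 : E <= c^-1 * (s * D) * E.
  by rewrite ler_peMl ?(ltW E0)// -ler_pdivrMl ?invr_gt0// invrK mulr1.
have h2 : 2^-1 * T x ^+ 2 / E <= 2^-1 * e x / E.
  by rewrite ler_wpM2r ?invr_ge0 ?(ltW E0)// ler_wpM2l.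
have h3 : T x <= 2^-1 * T x ^+ 2 / E + 2^-1 * E.
  rewrite -subr_ge0.
  have -> : 2^-1 * T x ^+ 2 / E + 2^-1 * E - T x = 2^-1 * (T x - E) ^+ 2 / E.
    by field; rewrite gt_eqF.
  by rewrite mulr_ge0 ?invr_ge0 ?(ltW E0)// mulr_ge0 ?sqr_ge0.
by move: h1 h2 h3; lra.
Qed.

End weighted_estimates.

(** * Energy estimate for [Phi(V'(1 - K/h)) h^2] on a tail *)

Section tail_estimate.
Context {R : realType} {Phi : R -> R} {theta : R} (Phg : young_growth Phi theta).
Local Notation leb := (@lebesgue_measure R).
Local Notation mfun D f := (@measurable_fun _ _ (measurableTypeR R) R D f).
Local Notation H := (modification Phi).

(** The form in which the hypotheses at infinity are used: the regularity of [V] becomes local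
    Lipschitz continuity of [V] and [V'], and the bound on [V''/V'^2] is multiplied out. *)
Definition tail (V : R -> R) (s M c q : R) : Prop := forall x, M <= s * x ->
  [/\ derivable V x 1, lipschitz_near V x,
      derivable V^`()%classic x 1, lipschitz_near V^`()%classic x &
      c <= s * V^`()%classic x /\
      (V^`()^`())%classic x <= q * V^`()%classic x ^+ 2].

(** The slope of [F] in [tail_estimate], with [phi = Phi z], [d = Phi' z],
  [D = V''], [E = e^-V] and [T] the slope of [h]. *)
Lemma tail_slope_bound (q s v d D phi eps C E h K T : R) :
  s = 1 \/ s = -1 -> 0 < v -> 0 <= q -> q * theta < 1 -> 0 < E -> 0 < K -> K <= h -> 0 <= T ->
  let z := v * (1 - K / h) in
  D <= q * v ^+ 2 -> 0 <= d -> phi <= z * d -> d <= theta * (phi / z) -> 0 <= phi ->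
  z * d <= theta * phi ->
  phi / z * (T / h) <= (1 - q * theta) / (2 * (theta + 2)) * phi + C ->
  s * (d * (s * D * (1 - K / h)) * (h ^+ 2 * (E / v)) +
     phi * (h ^+ 2 * (- (E * (s * D)) / v ^+ 2 - E * (s * v) / v))) +
   (d * (v * (K * T / h ^+ 2)) * (h ^+ 2 * (E / v)) + phi * (2 * (T * h) * (E / v))) <=
  (theta + 2) * C * h ^+ 2 * E - (1 - q * theta) / 2 * phi * h ^+ 2 * E.
Proof.
move=> s1 v0 q0 qth E0 K0 Kh T0 z Dq d0 phiz dphi phi0 zd CT.
have th0 := theta_gt0 Phg.
have h0 : 0 < h by rewrite (lt_le_trans K0).
have vn0 : v != 0 by rewrite gt_eqF.
have hn0 : h != 0 by rewrite gt_eqF.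
have ss : s ^+ 2 = 1 by case: s1 => ->; ring.
(* The part without [T] collects the derivatives of [V'], of [1/V'] and of [e^-V]; the last one
   produces the decisive [- phi]. *)
have E1 : s * (d * (s * D * (1 - K / h)) * (h ^+ 2 * (E / v)) +
     phi * (h ^+ 2 * (- (E * (s * D)) / v ^+ 2 - E * (s * v) / v))) =
  E * h ^+ 2 * (D / v ^+ 2 * (z * d - phi) - phi).
  have -> : s * (d * (s * D * (1 - K / h)) * (h ^+ 2 * (E / v)) +
     phi * (h ^+ 2 * (- (E * (s * D)) / v ^+ 2 - E * (s * v) / v))) =
    s ^+ 2 * (E * h ^+ 2 * (D / v ^+ 2 * (z * d - phi) - phi)).
    by rewrite /z; field; rewrite vn0 hn0.
  by rewrite ss mul1r.
have E2 : d * (v * (K * T / h ^+ 2)) * (h ^+ 2 * (E / v)) + phi * (2 * (T * h) * (E / v)) =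
  E * h ^+ 2 * ((d * (K / h) + 2 * (phi / v)) * (T / h)).
  by field; rewrite vn0 hn0.
rewrite E1 E2 -mulrDr.
have -> : (theta + 2) * C * h ^+ 2 * E - (1 - q * theta) / 2 * phi * h ^+ 2 * E =
  E * h ^+ 2 * ((theta + 2) * C - (1 - q * theta) / 2 * phi) by ring.
rewrite ler_pM2l ?mulr_gt0 ?exprn_gt0//.
(* Since [z d - phi >= 0], an upper bound on [D] suffices. With the [- phi] above, a margin
   [(1 - q theta) phi] remains, one half of which absorbs the slope of [h]. *)
have F1 : D / v ^+ 2 * (z * d - phi) <= q * theta * phi.
  rewrite (@le_trans _ _ (q * (z * d - phi)))//.
    rewrite ler_wpM2r ?subr_ge0// ler_pdivrMr ?exprn_gt0//.
  rewrite -mulrA ler_wpM2l// lerBlDr (le_trans zd)// lerDl//.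
have Khle1 : K / h <= 1 by rewrite ler_pdivrMr// mul1r.
have Kh0 : 0 <= K / h by rewrite divr_ge0// ltW.
have zv : z <= v by rewrite /z ler_piMr ?(ltW v0)// gerBl.
have z0 : 0 <= z by rewrite mulr_ge0 ?(ltW v0)// subr_ge0.
have F2 : phi / v <= phi / z.
  have [zE|zn0] := eqVneq z 0.
    have phi00 : phi = 0.
      by apply/eqP; rewrite eq_le phi0 andbT; move: phiz; rewrite zE mul0r.
    by rewrite phi00 !mul0r.
  have zp : 0 < z by rewrite lt_neqAle eq_sym zn0.
  by rewrite ler_wpM2l// lef_pV2.
(* Origin of [theta + 2]: [theta] comes from the slope of [1 - K/h] inside [Phi], and [2] from the
   slope of [h^2]. *)
have F3 : (d * (K / h) + 2 * (phi / v)) * (T / h) <= (theta + 2) * (phi / z * (T / h)).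
  rewrite [leRHS]mulrA ler_wpM2r ?divr_ge0 ?(ltW h0)// [leRHS]mulrDl lerD//; last by rewrite ler_wpM2l.
  by rewrite (le_trans _ dphi)// ler_piMr.
have F4 : (theta + 2) * (phi / z * (T / h)) <= (1 - q * theta) / 2 * phi + (theta + 2) * C.
  have t2 : 0 < theta + 2 by rewrite addr_gt0.
  rewrite (@le_trans _ _ ((theta + 2) * ((1 - q * theta) / (2 * (theta + 2)) * phi + C)))//.
    by rewrite ler_wpM2l// ltW.
  rewrite mulrDr lerD2r le_eqVlt; apply/orP; left; apply/eqP.
  by field; rewrite gt_eqF.
by move: F1 F3 F4; lra.
Qed.

Definition tail_arg (V h : R -> R) (s K x : R) : R :=
  s * V^`()%classic x * (1 - K / h x).

Lemma tail_arg_lipschitz_near (V h : R -> R) (s M c q K x : R) :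
  tail V s M c q -> M <= s * x -> lipschitz_near h x -> h x != 0 -> lipschitz_near (tail_arg V h s K) x.
Proof.
move=> tV /tV[_ _ _ lV1 _] lh h0; apply: lipschitz_nearM.
  by apply: lipschitz_nearM => //; exact: lipschitz_near_cst.
have -> : (fun y => 1 - K / h y) = (fun y => (fun=> 1) y + (fun=> - K) y * (h y)^-1).
  by apply/funext => y; rewrite mulNr.
apply: lipschitz_nearD; first exact: lipschitz_near_cst.
apply: lipschitz_nearM; first exact: lipschitz_near_cst.
by apply: (@lipschitz_near_comp R (@GRing.inv R) h) => //; exact: lipschitz_near_inv.
Qed.

(** The constant depends on [Phi], [theta] and [q] only. The hypothesis starts at [M - 2] because
    [ftc_le_oriented] needs a margin of [2]. The boundary term at [s * M] is left as it is, to be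
    bounded by the energy in [tail_energy]. *)
Lemma tail_estimate (q : R) : 0 <= q -> q * theta < 1 -> exists2 C : R, 0 <= C &
  forall (V h T e : R -> R) (s M c b K : R),
  s = 1 \/ s = -1 -> M <= b -> 0 < c -> tail V s (M - 2) c q -> 0 < K ->
  (forall x, lipschitz_near h x) -> (forall x, slope h x 0 (T x)) ->
  (forall x, 0 <= T x) -> (forall x, K <= h x) ->
  (forall x, H (T x / h x) * h x ^+ 2 <= e x) -> mfun setT e ->
  (\int[leb]_(x in oriented_itv s M b)
     ((1 - q * theta) / 2 * Phi (tail_arg V h s K x) * h x ^+ 2 * expR (- V x))%:E <=
   (Phi (tail_arg V h s K (s * M)) *
     (h (s * M) ^+ 2 * ((s * V^`()%classic (s * M))^-1 * expR (- V (s * M)))))%:E +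
   \int[leb]_(x in oriented_itv s M b) (C * e x * expR (- V x))%:E)%E.
Proof.
move=> q0 qth.
have th0 := theta_gt0 Phg.
have eps0 : 0 < (1 - q * theta) / (2 * (theta + 2)).
  by rewrite divr_gt0 ?subr_gt0// mulr_gt0// addr_gt0.
have [C C0 HC] := young_absorb Phg _ eps0.
exists ((theta + 2) * C); first by rewrite mulr_ge0// addr_ge0// ltW.
move=> V h T e s M c b K s1 Mb c0 tV K0 lh hT T0 Kh He me.
pose v x := s * V^`()%classic x; pose z := tail_arg V h s K.
have h0 x : 0 < h x by rewrite (lt_le_trans K0).
have v0 x : M - 2 <= s * x -> 0 < v x.
  by move=> /tV[_ _ _ _ [cv _]]; rewrite (lt_le_trans c0).
have z0 x : M - 2 <= s * x -> 0 <= z x.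
  move=> Mx; rewrite mulr_ge0 ?(ltW (v0 _ Mx))// subr_ge0 ler_pdivrMr// mul1r//.
have e0 x : 0 <= e x.
  rewrite (le_trans _ (He x))// mulr_ge0 ?sqr_ge0//.
  exact: (modification_ge0 Phg).
have lv x : M - 2 <= s * x -> lipschitz_near v x.
  by move=> /tV[_ _ _ lV1 _]; apply: lipschitz_nearM => //; exact: lipschitz_near_cst.
have lz x : M - 2 <= s * x -> lipschitz_near z x.
  by move=> Mx; apply: tail_arg_lipschitz_near tV Mx _ _ => //; rewrite gt_eqF.
have lPz x : M - 2 <= s * x -> lipschitz_near (fun y => Phi (z y)) x.
  move=> Mx; apply: (@lipschitz_near_comp R Phi z); first exact: lz.
  exact: (young_lipschitz_near Phg).
have lE x : M - 2 <= s * x -> lipschitz_near (fun y => expR (- V y)) x.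
  by move=> /tV[_ lVx _ _ _]; exact: lipschitz_near_expRN.
have lh2 x : lipschitz_near (fun y => h y ^+ 2) x by apply: lipschitz_nearM.
pose F x := Phi (z x) * (h x ^+ 2 * ((v x)^-1 * expR (- V x))).
have lF x : M - 2 <= s * x -> lipschitz_near F x.
  move=> Mx; apply: lipschitz_nearM; first exact: lPz.
  apply: lipschitz_nearM => //; apply: lipschitz_nearM; last exact: lE.
  apply: (@lipschitz_near_comp R (@GRing.inv R) v); first exact: lv.
  by apply: lipschitz_near_inv; rewrite gt_eqF// v0.
have := @ftc_le_oriented R s F
  (fun x => (1 - q * theta) / 2 * Phi (z x) * h x ^+ 2 * expR (- V x))
  (fun x => (theta + 2) * C * e x * expR (- V x)) M b s1 Mb.
move=> FTC; apply: le_trans (FTC _ _ _ _ _).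
(* The boundary term at [s * b] is nonnegative and is dropped, so the bound is uniform in [b]. *)
- rewrite leeDr// lee_fin /F.
  have Mb2 : M - 2 <= s * (s * b).
    by rewrite mulrA (_ : s * s = 1) ?mul1r; [lra|case: s1 => ->; ring].
  apply: mulr_ge0; first exact: young_ge0 Phg _.
  apply: mulr_ge0; first exact: sqr_ge0.
  by rewrite mulr_ge0 ?expR_ge0// invr_ge0 ltW// v0.
- by move=> x /andP[Mx _]; exact: lF.
- move=> x /andP[Mx _]; have Mx2 : M - 2 <= s * x by lra.
  apply: lipschitz_near_cont; apply: lipschitz_nearM; last exact: lE.
  apply: lipschitz_nearM => //; apply: lipschitz_nearM; [exact: lipschitz_near_cst|exact: lPz].
- apply: measurable_funM.
    by apply: measurable_funM => //; exact: measurable_funTS.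
  apply: mfun_oriented_itv => // x /andP[Mx _]; apply: lipschitz_near_cont; apply: lE; lra.
- move=> x _; rewrite !mulr_ge0 ?expR_ge0// addr_ge0// ltW//.
move=> x /andP[Mx _]; have Mx2 : M - 2 <= s * x by lra.
have [dV _ dV1 _ [cv qV]] := tV x Mx2.
have hx0 := h0 x; have vx0 := v0 x Mx2; have zx0 := z0 x Mx2.
have hn0 : h x != 0 by rewrite gt_eqF.
have vn0 : v x != 0 by rewrite gt_eqF.
set D := (V^`()^`())%classic x.
set P := 1 - K / h x.
have P0 : 0 <= P by rewrite subr_ge0 ler_pdivrMr// mul1r.
have Sih := slope_inv h x _ _ (hT x) hn0.
have Sp0 : slope (fun y => 1 + - K * (h y)^-1) x 0 (K * T x / h x ^+ 2).
  apply: (slope_eq (slopeD (slope_cst 1 x) (slopeM (slope_cst (- K) x) Sih))).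
    by ring.
  by rewrite normrN (gtr0_norm K0); ring.
have Sp : slope (fun y => 1 - K / h y) x 0 (K * T x / h x ^+ 2).
  by have := Sp0; under eq_fun do rewrite mulNr.
have Sv : slope v x (s * D) 0.
  apply: (slope_eq (slopeM (slope_cst s x) (slope_derivable x dV1))); first by rewrite /D; ring.
  by ring.
have Sz : slope z x (s * D * P) (v x * (K * T x / h x ^+ 2)).
  apply: (slope_eq (slopeM Sv Sp)); first by rewrite -/P; ring.
  by rewrite (gtr0_norm vx0); ring.
set d := Phi^`()%classic (z x).
have d0 : 0 <= d by exact: (young_derive_ge0 Phg).
have SPz : slope (fun y => Phi (z y)) x (d * (s * D * P)) (d * (v x * (K * T x / h x ^+ 2))).
  apply: (slope_eq (slope_comp Sz (young_derivable Phg (z x)))) => //.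
  by rewrite ger0_norm.
have Sh2 : slope (fun y => h y ^+ 2) x 0 (2 * (T x * h x)).
  apply: (slope_eq (slopeM (hT x) (hT x))); first by ring.
  by rewrite (gtr0_norm hx0); ring.
have Siv := slope_inv v x _ _ Sv vn0.
have SE := slope_expRN V x dV.
set E := expR (- V x) in SE; have E0 : 0 < E by rewrite expR_gt0.
have SU : slope (fun y => (v y)^-1 * expR (- V y)) x
   (- (E * (s * D)) / v x ^+ 2 - E * (s * v x) / v x) 0.
  apply: (slope_eq (slopeM Siv SE)); last by ring.
  have VE : V^`()%classic x = s * v x.
    by rewrite /v mulrA (_ : s * s = 1) ?mul1r//; case: s1 => ->; ring.
  by rewrite VE -/E; field.
have SW : slope (fun y => h y ^+ 2 * ((v y)^-1 * expR (- V y))) x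
   (h x ^+ 2 * (- (E * (s * D)) / v x ^+ 2 - E * (s * v x) / v x))
   (2 * (T x * h x) * (E / v x)).
  apply: (slope_eq (slopeM Sh2 SU)); first by rewrite mul0r add0r.
  by rewrite -/E mulr0 addr0 ger0_norm ?mulr_ge0 ?invr_ge0 ?(ltW E0) ?(ltW vx0)//; ring.
have Phi0 : 0 <= Phi (z x) by exact: young_ge0 Phg _.
exists (d * (s * D * P) * (h x ^+ 2 * (E / v x)) +
     Phi (z x) * (h x ^+ 2 * (- (E * (s * D)) / v x ^+ 2 - E * (s * v x) / v x))).
exists (d * (v x * (K * T x / h x ^+ 2)) * (h x ^+ 2 * (E / v x)) +
   Phi (z x) * (2 * (T x * h x) * (E / v x))); split.
  have W0 : 0 <= h x ^+ 2 * (E / v x).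
    apply: mulr_ge0; first exact: sqr_ge0.
    by rewrite mulr_ge0 ?invr_ge0 ?(ltW E0) ?(ltW vx0).
  apply: (slope_eq (slopeM SPz SW)); rewrite -/E [(v x)^-1 * E]mulrC//.
  by rewrite (ger0_norm W0) (ger0_norm Phi0).
rewrite (le_trans (y := (theta + 2) * (C * H (T x / h x)) * h x ^+ 2 * E
  - (1 - q * theta) / 2 * Phi (z x) * h x ^+ 2 * E))//; last first.
  rewrite lerD2r ler_wpM2r ?(ltW E0)//.
  have -> : (theta + 2) * (C * H (T x / h x)) * h x ^+ 2 =
    (theta + 2) * C * (H (T x / h x) * h x ^+ 2) by ring.
  by rewrite ler_wpM2l// mulr_ge0// addr_ge0// ltW.
apply: tail_slope_bound => //.
- have VE : V^`()%classic x ^+ 2 = v x ^+ 2.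
    by rewrite /v exprMn (_ : s ^+ 2 = 1) ?mul1r//; case: s1 => ->; ring.
  by rewrite -VE.
- exact: (young_derive_ge Phg).
- exact: (young_derive_le Phg).
- change (z x * d <= theta * Phi (z x)); have [zE|zn0] := eqVneq (z x) 0.
    by rewrite {1}zE mul0r mulr_ge0// ltW.
  have zp : 0 < z x by rewrite lt_neqAle eq_sym zn0.
  have := young_derive_le Phg _ zx0.
  by rewrite mulrA ler_pdivlMr// mulrC.
- by apply: HC => //; rewrite divr_ge0 ?T0// ltW.
Qed.

End tail_estimate.

Lemma ge0_integral_setU_le d (T : measurableType d) (R : realType)
    (mu : {measure set T -> \bar R}) (A B : set T) (f : T -> \bar R) :
  measurable A -> measurable B -> measurable_fun setT f -> (forall x, 0 <= f x)%E ->
  (\int[mu]_(x in A `|` B) f x <= \int[mu]_(x in A) f x + \int[mu]_(x in B) f x)%E.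
Proof.
move=> mA mB mf f0; have mBA : measurable (B `\` A) by exact: measurableD.
have -> : A `|` B = A `|` (B `\` A) by rewrite setUDr setDv setD0.
rewrite ge0_integral_setU//; last 2 first.
- exact: measurable_funTS.
- by apply/disj_setPS => x [Ax []].
by rewrite leeD2l// ge0_subset_integral//; exact: measurable_funTS.
Qed.

(** * Splitting integrals into centre and tails, and recentring a variance *)

Section integrals.
Context {R : realType} (mu : probability (measurableTypeR R) R).
Implicit Types (f Q : R -> R) (k M : R).
Local Notation mfun D f := (@measurable_fun _ _ (measurableTypeR R) R D f).

Lemma integral_pieces Q M (a0 a1 : R) : 0 <= M -> mfun setT Q -> (forall x, 0 <= Q x) ->
  (\int[mu]_(x in oriented_itv 1 (- M) M) (Q x)%:E <= a0%:E)%E ->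
  (forall s b, s = 1 \/ s = -1 -> M <= b ->
    (\int[mu]_(x in oriented_itv s M b) (Q x)%:E <= a1%:E)%E) ->
  (\int[mu]_x (Q x)%:E <= (a0 + a1 + a1)%:E)%E.
Proof.
move=> M0 mQ Q0 I0 I1.
pose D (n : nat) : set (measurableTypeR R) := oriented_itv 1 (- (M + n%:R)) (M + n%:R).
have mO s a b : s = 1 \/ s = -1 -> @measurable _ (measurableTypeR R) (oriented_itv s a b).
  exact: measurable_oriented_itv.
have mD n : @measurable _ (measurableTypeR R) (D n) by apply: mO; left.
have ndD : nondecreasing_seq D.
  move=> m n mn; rewrite subsetEset => x; rewrite /D /oriented_itv/= => /andP[h1 h2].
  have mnR : m%:R <= n%:R :> R by rewrite ler_nat.
  by apply/andP; split; lra.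
have UD : \bigcup_n D n = setT.
  apply/seteqP; split => // x _; exists (Num.bound x) => //.
  have := archi_boundP (normr_ge0 x); rewrite /D /oriented_itv/= mul1r.
  have -> : Num.bound `|x| = Num.bound x by rewrite /Num.bound normr_id.
  move=> /ltW; rewrite ler_norml; move: (_%:R) => n; lra.
have mQE : @measurable_fun _ _ (measurableTypeR R) (\bar R) setT (EFin \o Q).
  exact/mfun_EFinP.
have mQD (A : set (measurableTypeR R)) :
    @measurable_fun _ _ (measurableTypeR R) (\bar R) A (EFin \o Q).
  exact: measurable_funTS.
have QE0 x : (0 <= (EFin \o Q) x)%E by rewrite lee_fin.
have cv := @ge0_nondecreasing_set_cvg_integral _ (measurableTypeR R) R D (EFin \o Q) mu
  ndD mD (fun i => mQD _) (fun i x _ => QE0 x).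
rewrite UD in cv.
have Dle n : (\int[mu]_(x in D n) (EFin \o Q) x <= (a0 + a1 + a1)%:E)%E.
  have Mn : M <= M + n%:R by rewrite lerDl.
  have DU : D n `<=` (oriented_itv 1 (- M) M `|` oriented_itv 1 M (M + n%:R)) `|` oriented_itv (-1) M (M + n%:R).
    move=> x; rewrite /D /oriented_itv/= => /andP[h1 h2].
    have [xM|xM] := leP x M; last by left; right; lra.
    have [xM'|xM'] := leP (- M) x; first by left; left; lra.
    by right; lra.
  have mU2 : @measurable _ (measurableTypeR R) (oriented_itv 1 (- M) M `|` oriented_itv 1 M (M + n%:R)).
    by apply: measurableU; apply: mO; left.
  have mU3 := measurableU _ _ mU2 (mO (-1) M (M + n%:R) (or_intror erefl)).
  apply: (le_trans (@ge0_subset_integral _ _ _ mu _ _ (mD n) mU3 _ (mQD _) (fun x _ => QE0 x) DU)).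
  have subadd (A B : set (measurableTypeR R)) (mA : measurable A) (mB : measurable B) :=
    @ge0_integral_setU_le _ _ _ mu A B _ mA mB mQE QE0.
  rewrite (le_trans (subadd _ _ _ _))//.
    by apply: mO; right.
  rewrite !EFinD leeD//; last by apply: I1 => //; right.
  rewrite (le_trans (subadd _ _ _ _))//; [by apply: mO; left|by apply: mO; left|].
  by rewrite leeD//; apply: I1 => //; left.
by apply: (cvge_le _ cv); apply: nearW.
Qed.

(** The Poincare inequality is centred at a value of [f], whereas the entropy density is compared
    with [(f - 1)^2]. With [m = int f], which lies in [[0, 1]], the two sides differ by
    [2 ((k - m)^2 + m (1 - m))]. *)
Lemma variance_bound f k : mfun setT f -> (forall x, 0 <= f x) ->
  (\int[mu]_x (f x ^+ 2)%:E = 1)%E ->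
  (\int[mu]_x ((f x - 1) ^+ 2)%:E <= 2%:E * \int[mu]_x ((f x - k) ^+ 2)%:E)%E.
Proof.
move=> mf f0 f1.
have mT : @measurable _ (measurableTypeR R) setT by exact: measurableT.
have mf2 : mfun setT (fun x => f x ^+ 2) by exact: measurable_funM.
have i2 : mu.-integrable setT (EFin \o (fun x => f x ^+ 2)).
  apply/integrableP; split; first exact/mfun_EFinP.
  under eq_integral do rewrite /= ger0_norm ?sqr_ge0//.
  by rewrite f1 ltry.
have ic (c : R) : mu.-integrable setT (EFin \o (fun=> c)).
  exact: finite_measure_integrable_cst.
have i1 : mu.-integrable setT (EFin \o f).
  apply: (@le_integrable _ _ _ _ _ mT _ (EFin \o (fun x => f x ^+ 2 + 1))).
  - exact/mfun_EFinP.
  - move=> x _ /=; rewrite lee_fin ger0_norm// ger0_norm ?addr_ge0 ?sqr_ge0//.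
    rewrite -subr_ge0; have -> : f x ^+ 2 + 1 - f x = (f x - 2^-1) ^+ 2 + 3 / 4 by field.
    by rewrite addr_ge0 ?sqr_ge0// divr_ge0.
  - exact: (integrableD mT i2 (ic 1)).
pose m := \int[mu]_x (f x).
have sqE c : (\int[mu]_x ((f x - c) ^+ 2)%:E)%E = (1 - 2 * c * m + c ^+ 2)%:E.
  have ZI : mu.-integrable setT (EFin \o (fun x => - (2 * c) * f x)).
    exact: (integrableZl mT _ i1).
  have i3 : mu.-integrable setT (EFin \o (fun x => - (2 * c) * f x + c ^+ 2)).
    exact: (integrableD mT ZI (ic _)).
  have -> : (\int[mu]_x ((f x - c) ^+ 2)%:E =
      \int[mu]_x (f x ^+ 2 + (- (2 * c) * f x + c ^+ 2))%:E)%E.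
    by apply: eq_integral => x _; congr (_%:E); ring.
  have i4 : mu.-integrable setT (EFin \o (fun x => f x ^+ 2 + (- (2 * c) * f x + c ^+ 2))).
    exact: (integrableD mT i2 i3).
  rewrite -[LHS]fineK ?(integrable_fin_num _ i4)//; congr (_%:E).
  rewrite -/(Rintegral mu setT (fun x => f x ^+ 2 + (- (2 * c) * f x + c ^+ 2))).
  rewrite RintegralD// RintegralD// RintegralZl// Rintegral_cst//.
  rewrite /Rintegral f1 /= -/(Rintegral _ _ _) -/m.
  have -> : fine (mu setT) = 1 by rewrite probability_setT.
  by rewrite mulr1; ring.
rewrite !sqE -EFinM lee_fin.
have m0 : 0 <= m by apply: Rintegral_ge0 => x _.
have m1 : m <= 1.
  have : 0 <= 1 - 2 * 1 * m + 1 ^+ 2.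
    by rewrite -lee_fin -sqE; apply: integral_ge0 => x _; rewrite lee_fin sqr_ge0.
  by lra.
rewrite -subr_ge0.
have -> : 2 * (1 - 2 * k * m + k ^+ 2) - (1 - 2 * 1 * m + 1 ^+ 2) =
  2 * ((k - m) ^+ 2 + m * (1 - m)) by ring.
by rewrite mulr_ge0// addr_ge0 ?sqr_ge0// mulr_ge0// subr_ge0.
Qed.

End integrals.

(** * Truncation and pointwise bounds on the entropy density *)

Lemma maxr_dist {R : realType} (a b k : R) :
  `|Num.max a k - Num.max b k| <= `|a - b|.
Proof.
have h1 := ler_norm (a - b); have h2 := ler_norm (b - a).
rewrite distrC in h2; rewrite ler_norml.
have [ak|ka] := leP a k; have [bk|kb] := leP b k; apply/andP; split; lra.
Qed.

(** Under a probability with [int y^2 = 1] the correction [- y^2 + 1] integrates to [0], so this has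
    the entropy as its integral; unlike [y^2 ln y^2] it is nonnegative and can be estimated piece by
    piece. *)
Definition ent_density {R : realType} (y : R) : R := y ^+ 2 * ln (y ^+ 2) - y ^+ 2 + 1.

Lemma ln_le_subr1 {R : realType} (x : R) : 0 < x -> ln x <= x - 1.
Proof.
move=> x0; have := @le_ln1Dx R (x - 1).
by rewrite [1 + _]addrC subrK; apply; lra.
Qed.

Lemma ent_density_ge0 {R : realType} (y : R) : 0 <= ent_density y.
Proof.
rewrite /ent_density; have [->|y0] := eqVneq y 0; first by rewrite expr0n mul0r subr0 add0r.
have t0 : 0 < y ^+ 2 by rewrite lt_neqAle sqr_ge0 andbT eq_sym sqrf_eq0.
move: (y ^+ 2) t0 => t t0.
have : ln t^-1 <= t^-1 - 1 by apply: ln_le_subr1; rewrite invr_gt0.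
rewrite lnV ?posrE// => h.
have : t * (- ln t) <= t * (t^-1 - 1) by rewrite ler_pM2l.
rewrite mulrBr divff ?gt_eqF// mulr1 mulrN; lra.
Qed.

Lemma ln_sqr {R : realType} (y : R) : 0 < y -> ln (y ^+ 2) = 2 * ln y.
Proof. by move=> y0; rewrite lnXn// mulr_natl. Qed.

(** Insert [ln y <= y - 1]; what results factors exactly, with [1] as a double root. *)
Lemma ent_density_le {R : realType} (y : R) : 0 <= y ->
  ent_density y <= (2 * y + 1) * (y - 1) ^+ 2.
Proof.
rewrite le_eqVlt => /orP[/eqP <-|y0].
  by rewrite /ent_density expr0n mul0r subr0 mulr0 !add0r mul1r sqrrN expr1n.
rewrite /ent_density ln_sqr//.
have h : y ^+ 2 * (2 * ln y) <= y ^+ 2 * (2 * (y - 1)).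
  by rewrite ler_wpM2l ?sqr_ge0// ler_pM2l// ln_le_subr1.
have -> : (2 * y + 1) * (y - 1) ^+ 2 = y ^+ 2 * (2 * (y - 1)) - y ^+ 2 + 1 by ring.
by rewrite lerD2r lerD2r.
Qed.

(** If [y <= 2K], the factor [2 y + 1] is at most [4 K + 1]. If [y > 2K], then
    [ln y <= ln C + E + P], and the share of [ln C] is moved to [(y - 1)^2]. The share of [E] may
    keep [y^2], since [int y^2 = 1] turns it into a multiple of [E]; the share of [P] occurs only
    where [1 - K/y > 1/2]. *)
Lemma ent_density_growth {R : realType} (y K E C P : R) : 0 <= y -> 1 <= K -> 0 <= E ->
  1 <= C -> y <= C * (1 + E) * expR P ->
  ent_density y <= (4 * K + 1 + 8 * ln C) * (y - 1) ^+ 2 + 2 * E * y ^+ 2 +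
    (if 2 * K < y then 2 * P * y ^+ 2 else 0).
Proof.
move=> y0 K1 E0 C1 yC; have lC0 : 0 <= ln C by exact: ln_ge0.
have Ey : 0 <= 2 * E * y ^+ 2 by rewrite mulr_ge0 ?sqr_ge0// mulr_ge0.
have ly : 0 <= 8 * ln C * (y - 1) ^+ 2 by rewrite mulr_ge0 ?sqr_ge0// mulr_ge0.
have Ky : 0 <= (4 * K + 1) * (y - 1) ^+ 2.
  by rewrite mulr_ge0 ?sqr_ge0// addr_ge0// mulr_ge0// (le_trans ler01).
rewrite mulrDl; case: ltP => [yK|yK]; last first.
  rewrite addr0 (le_trans (ent_density_le y y0))//.
  have : (2 * y + 1) * (y - 1) ^+ 2 <= (4 * K + 1) * (y - 1) ^+ 2.
    by rewrite ler_wpM2r ?sqr_ge0//; lra.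
  by move: Ey ly; lra.
have yp : 0 < y by rewrite (lt_trans _ yK)//; lra.
have CE0 : 0 < C * (1 + E) by rewrite mulr_gt0//; lra.
have lny : ln y <= ln C + E + P.
  have : ln y <= ln (C * (1 + E) * expR P) by rewrite ler_ln ?posrE ?mulr_gt0 ?expR_gt0//; lra.
  rewrite lnM ?posrE ?expR_gt0// expRK lnM ?posrE; [|lra|lra].
  have : ln (1 + E) <= E by have := @ln_le_subr1 R (1 + E); lra.
  lra.
rewrite /ent_density ln_sqr//.
have h1 : y ^+ 2 * (2 * ln y) <= y ^+ 2 * (2 * (ln C + E + P)).
  by rewrite ler_wpM2l ?sqr_ge0// ler_pM2l.
(* Here [y > 2K >= 2]; hence the [8 ln C] of the statement. *)
have h2 : y ^+ 2 <= 4 * (y - 1) ^+ 2.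
  rewrite -subr_ge0.
  have -> : 4 * (y - 1) ^+ 2 - y ^+ 2 = (y - 2) * (3 * y - 2) by ring.
  by rewrite mulr_ge0//; lra.
have h3 : 2 * ln C * y ^+ 2 <= 2 * ln C * (4 * (y - 1) ^+ 2).
  by rewrite ler_wpM2l// mulr_ge0.
have h4 : 1 <= y ^+ 2 by rewrite expr_ge1//; lra.
have e1 : y ^+ 2 * (2 * (ln C + E + P)) = 2 * ln C * y ^+ 2 + 2 * E * y ^+ 2 + 2 * P * y ^+ 2.
  by ring.
have e2 : 2 * ln C * (4 * (y - 1) ^+ 2) = 8 * ln C * (y - 1) ^+ 2 by ring.
rewrite e1 in h1; rewrite e2 in h3.
move: h1 h3 h4 Ky; move: (y ^+ 2 * _) ((y - 1) ^+ 2) => u w.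
move: (2 * ln C * y ^+ 2) (2 * E * y ^+ 2) (2 * P * y ^+ 2) (8 * ln C * w) ((4 * K + 1) * w) => ? ? ? ? ?.
lra.
Qed.

(** * From the tail estimate to the entropy *)

Section entropy_energy.
Context {R : realType} {Phi : R -> R} {theta : R} (Phg : young_growth Phi theta).
Context (V : R -> R) (mu : probability (measurableTypeR R) R).
Context (mu_V : has_density_expN mu V) (M c q CV BV : R).
Context (M0 : 0 <= M) (c0 : 0 < c) (q0 : 0 <= q) (qth : q * theta < 1).
Context (tails : forall s : R, s = 1 \/ s = -1 -> tail V s (M - 2) c q).
Context (V_Phi : forall s x : R, s = 1 \/ s = -1 -> M <= s * x ->
  V x <= CV * Phi (s * V^`()%classic x)) (CV0 : 0 <= CV).
Context (V_bnd : forall x, `|x| <= M -> `|V x| <= BV).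
Implicit Types (f S e h T : R -> R) (E : R).
Local Notation leb := (@lebesgue_measure R).
Local Notation mfun D f := (@measurable_fun _ _ (measurableTypeR R) R D f).
Local Notation H := (modification Phi).

(** The density [e] is only required to dominate, so that one and the same [e] serves every
    truncation of [f]. *)
Record energy_data f S e E : Prop := EnergyData {
  ed_lip : forall x, lipschitz_near f x ;
  ed_slope : forall x, slope f x 0 (S x) ;
  ed_S0 : forall x, 0 <= S x ;
  ed_f0 : forall x, 0 <= f x ;
  ed_e : forall x, H (S x / f x) * f x ^+ 2 <= e x ;
  ed_meas : mfun setT e ;
  ed_E : (\int[mu]_x (e x)%:E = E%:E)%E }.

Lemma mu_density (g : R -> R) (D : set (measurableTypeR R)) :
  measurable D -> mfun D g -> (forall x, 0 <= g x) ->
  (\int[mu]_(x in D) (g x)%:E = \int[leb]_(x in D) (g x * expR (- V x))%:E)%E.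
Proof.
have [mV muE] := mu_V => mD mg g0.
apply: (@ge0_integral_density _ (measurableTypeR R) R mu leb (fun x => expR (- V x)) g D) => //.
by apply: measurableT_comp => //; exact: measurableT_comp.
Qed.

Lemma ed_e0 f S e E : energy_data f S e E -> forall x, 0 <= e x.
Proof.
case=> _ _ _ _ He _ _ x; rewrite (le_trans _ (He x))// mulr_ge0 ?sqr_ge0//.
exact: modification_ge0 Phg _.
Qed.

Lemma ed_E0 f S e E : energy_data f S e E -> 0 <= E.
Proof.
move=> ed; rewrite -lee_fin -(ed_E _ _ _ _ ed); apply: integral_ge0 => x _.
by rewrite lee_fin; exact: ed_e0 ed x.
Qed.

Lemma energy_leb f S e E (k : R) (D : set (measurableTypeR R)) :
  energy_data f S e E -> measurable D -> 0 <= k ->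
  (\int[leb]_(x in D) (k * e x * expR (- V x))%:E <= (k * E)%:E)%E.
Proof.
move=> ed mD k0; have e0 := ed_e0 _ _ _ _ ed; have me := ed_meas _ _ _ _ ed.
have mke (A : set (measurableTypeR R)) : mfun A (fun x => k * e x).
  by apply: measurable_funM => //; exact: measurable_funTS.
rewrite -mu_density//; last by move=> x; rewrite mulr_ge0.
have mT : @measurable _ (measurableTypeR R) setT by exact: measurableT.
apply: (@le_trans _ _ (\int[mu]_x (k * e x)%:E)%E).
  apply: (@ge0_subset_integral _ _ _ mu D setT mD mT (fun x => (k * e x)%:E)) => //.
    exact/mfun_EFinP.
  by move=> x _; rewrite lee_fin mulr_ge0.
under eq_integral do rewrite EFinM.
rewrite ge0_integralZl_EFin//; first by rewrite (ed_E _ _ _ _ ed) EFinM.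
- by move=> x _; rewrite lee_fin.
- exact/mfun_EFinP.
Qed.

(** Truncating from below by [k > 0] discards the zeros of [f], where
  [e x = 0] gives no control on the slope of [f]. *)
Lemma truncation f S e E (k : R) : energy_data f S e E -> 0 < k ->
  let h x := Num.max (f x) k in
  exists T, [/\ forall x, lipschitz_near h x, forall x, slope h x 0 (T x),
    forall x, 0 <= T x, forall x, H (T x / h x) * h x ^+ 2 <= e x &
    forall x, T x ^+ 2 <= e x].
Proof.
move=> ed k0 h; have [lf sf S0 f0 He _ _] := ed.
have e0 := ed_e0 _ _ _ _ ed.
have dqh x n : `|diff_quot h x n| <= `|diff_quot f x n|.
  by rewrite /diff_quot !normrM ler_wpM2r// maxr_dist.
have h0 x : 0 < h x by rewrite /h lt_max k0 orbT.
pose T x := if k <= f x then S x else 0.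
have HT x : H (T x / h x) * h x ^+ 2 <= e x.
  rewrite /T; case: ifPn => [kf|_].
    by rewrite /h max_l.
  by rewrite mul0r /modification normr0 ler01 expr0n mul0r.
exists T; split => //.
- move=> x; have [C [r [C0 r0 Cf]]] := lf x.
  exists C, r; split => // y z yr zr.
  by rewrite (le_trans (maxr_dist _ _ _))// Cf.
- move=> x eta eta0; rewrite /T; case: ifPn => [kf|].
    have := sf x eta eta0; apply: filterS => n; rewrite !subr0.
    exact: le_trans (dqh x n).
  rewrite -ltNge => fk.
  have : \forall n \near \oo, f (x + n.+1%:R^-1) < k.
    exact: (cvgr_lt _ (slope_shift (sf x))).
  apply: filterS => n fnk.
  by rewrite /diff_quot /h !max_r ?(ltW fk) ?(ltW fnk)// subrr mul0r subr0 normr0 add0r ltW.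
- by move=> x; rewrite /T; case: ifP.
- move=> x; rewrite (le_trans _ (HT x))//.
  rewrite (@le_trans _ _ ((T x / h x) ^+ 2 * h x ^+ 2))//.
    by rewrite -exprMn divfK ?gt_eqF.
  by rewrite ler_wpM2r ?sqr_ge0// (modification_sqr Phg).
Qed.

(** The factor [2] is [2 / c] with [c = 1]; [e^(M + BV)] compares the weight [e^(-s x)] with [e^-V]
    on the centre, and the remaining [e^M] removes that weight at the end point. *)
Definition osc_const : R := 2 * expR (M + M + BV).

Lemma osc_const_ge0 : 0 <= osc_const. Proof. by rewrite mulr_ge0// expR_ge0. Qed.

(** In the centre [V] is merely bounded, so [weighted_poincare] is used with the linear weight
    [W = s * y] instead. Taking [k] as the value of [h] at the initial point kills the first
    boundary term, and the other one is the squared oscillation. The sign [s = -1] handles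
    [x < x0]. *)
Lemma interior_osc f S e E h T x0 x : energy_data f S e E ->
  (forall x, lipschitz_near h x) -> (forall x, slope h x 0 (T x)) ->
  (forall x, 0 <= T x) -> (forall x, T x ^+ 2 <= e x) ->
  `|x0| <= M -> `|x| <= M -> (h x - h x0) ^+ 2 <= osc_const * E.
Proof.
move=> ed lh sh T0 Te x0M xM.
have key (s a b : R) : s = 1 \/ s = -1 -> a <= b -> `|a| <= M -> `|b| <= M ->
    (h (s * b) - h (s * a)) ^+ 2 <= osc_const * E.
  move=> s1 ab aM bM.
  have ss : s * s = 1 by case: s1 => ->; ring.
  have dW (x' : R) : is_derive x' 1 (fun y : R => s * y) s.
    by apply: is_derive_eq; rewrite /GRing.scale/= ?mulr0 ?add0r ?addr0 mulr1.
  have lW (x' : R) : a - 2 <= s * x' <= b + 2 -> lipschitz_near (fun y => s * y) x'.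
    by move=> _; apply: lipschitz_nearM; [exact: lipschitz_near_cst|exact: lipschitz_near_id].
  have cW (x' : R) : a <= s * x' <= b -> derivable (fun y => s * y) x' 1 /\
      1 <= s * (fun y => s * y)^`()%classic x'.
    by move=> _; split; [|rewrite derive1E derive_val ss].
  have WP := @weighted_poincare R s a b 1 (h (s * a)) (fun y => s * y) h T e s1 ab ltr01
    lW cW lh sh T0 Te (ed_meas _ _ _ _ ed).
  rewrite subrr expr0n mul0r add0e in WP.
  have e0 := ed_e0 _ _ _ _ ed; have me := ed_meas _ _ _ _ ed.
  have mO1 := measurable_oriented_itv s a b s1.
  have mE1 : mfun (oriented_itv s a b) (fun x => 2 / 1 * e x * expR (- (s * x))).
    apply: measurable_funM.
      by apply: measurable_funM => //; exact: measurable_funTS.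
    apply: mfun_oriented_itv => // x' xab; apply: lipschitz_near_cont; apply: lipschitz_near_expRN.
    by apply: lipschitz_nearM; [exact: lipschitz_near_cst|exact: lipschitz_near_id].
  have mE2 : mfun (oriented_itv s a b) (fun x => 2 * expR (M + BV) * e x * expR (- V x)).
    apply: measurable_funM.
      by apply: measurable_funM => //; exact: measurable_funTS.
    apply: measurable_funTS; apply: measurableT_comp => //.
    by apply: measurableT_comp => //; exact: mu_V.1.
  have I1 : (\int[leb]_(x in oriented_itv s a b) (2 / 1 * e x * expR (- (s * x)))%:E <=
      (2 * expR (M + BV) * E)%:E)%E.
    have k0 : 0 <= 2 * expR (M + BV) by rewrite mulr_ge0// expR_ge0.
    apply: le_trans (energy_leb _ _ _ _ _ _ ed mO1 k0).
    apply: (@ge0_le_integral _ (measurableTypeR R) R leb _ mO1).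
    - by move=> y _; rewrite lee_fin !mulr_ge0 ?expR_ge0.
    - exact/mfun_EFinP.
    - exact/mfun_EFinP.
    - move=> y /andP[ay yb]; rewrite lee_fin divr1.
      rewrite -!mulrA ler_pM2l// [leRHS]mulrCA ler_wpM2l// -expRD ler_expR.
      have yM : `|y| <= M.
        move: aM bM ay yb; case: s1 => ->; rewrite ?mul1r ?mulN1r !ler_norml; lra.
      have := V_bnd _ yM; move: aM; rewrite !ler_norml; lra.
  have Ge0 : (0 <= \int[leb]_(x in oriented_itv s a b)
     (1 / 2 * (h x - h (s * a)) ^+ 2 * expR (- (s * x)))%:E)%E.
    apply: integral_ge0 => y _; rewrite lee_fin; apply: mulr_ge0; last exact: expR_ge0.
    by apply: mulr_ge0; [rewrite divr_ge0|exact: sqr_ge0].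
  have {WP} := le_trans (leeDl _ Ge0) (le_trans WP I1).
  rewrite lee_fin mulrA ss mul1r expRN ler_pdivrMr ?expR_gt0// => /le_trans; apply.
  rewrite /osc_const [leLHS]mulrAC ler_wpM2r ?(ed_E0 _ _ _ _ ed)//.
  rewrite -mulrA -expRD ler_wpM2l// ler_expR.
  by move: bM; rewrite ler_norml; lra.
have [xx|/ltW xx] := leP x0 x.
  by have := key 1 x0 x; rewrite !mul1r; apply => //; left.
have := key (-1) (- x0) (- x); rewrite !mulN1r !opprK; apply => //.
- by right.
- by rewrite lerN2.
- by rewrite normrN.
- by rewrite normrN.
Qed.

(** The bracket adds the boundary term at [s * M], bounded through [osc_const], to the energy term
    [2 / c]; [c / 2] is the coefficient on the left of [weighted_poincare]. *)
Definition tail_const : R := (c / 2)^-1 * (osc_const * expR BV + 2 / c).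

Definition poincare_const : R := 2 * (osc_const + tail_const + tail_const).

Lemma tail_const_ge0 : 0 <= tail_const.
Proof.
by rewrite mulr_ge0 ?invr_ge0 ?divr_ge0 ?(ltW c0)// addr_ge0 ?mulr_ge0 ?expR_ge0 ?osc_const_ge0// invr_ge0 ltW.
Qed.

Lemma poincare_const_ge0 : 0 <= poincare_const.
Proof. by rewrite mulr_ge0// !addr_ge0 ?osc_const_ge0 ?tail_const_ge0. Qed.

Lemma lipschitz_near_mfun h : (forall x, lipschitz_near h x) -> mfun setT h.
Proof.
by move=> lh; apply: continuous_measurable_fun => x; exact: lipschitz_near_cont (lh x).
Qed.

Lemma norm_signM_le (s : R) : s = 1 \/ s = -1 -> `|s * M| <= M.
Proof. by case=> ->; rewrite ?mul1r ?mulN1r ?normrN ger0_norm. Qed.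

Lemma sign_mulKself (s : R) : s = 1 \/ s = -1 -> s * s = 1.
Proof. by case=> ->; ring. Qed.

Lemma expRN_bnd x : `|x| <= M -> expR (- V x) <= expR BV.
Proof. by move=> /V_bnd; rewrite ler_expR ler_norml; lra. Qed.

Lemma mu_integralZl (D : set (measurableTypeR R)) (k : R) (g : R -> R) :
  measurable D -> mfun D g -> (forall x, 0 <= g x) -> 0 <= k ->
  (\int[mu]_(x in D) (k * g x)%:E = k%:E * \int[mu]_(x in D) (g x)%:E)%E.
Proof.
move=> mD mg g0 k0; under eq_integral do rewrite EFinM.
rewrite ge0_integralZl_EFin//; first by move=> x _; rewrite lee_fin.
exact/mfun_EFinP.
Qed.

(** Now [W = V], and [k] is a value taken in the centre: the boundary point [s * M] also lies in the
    centre, so its contribution is an oscillation already bounded by [E]. *)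
Lemma tail_poincare f S e E h T x0 (s b : R) : energy_data f S e E ->
  (forall x, lipschitz_near h x) -> (forall x, slope h x 0 (T x)) ->
  (forall x, 0 <= T x) -> (forall x, T x ^+ 2 <= e x) ->
  `|x0| <= M -> s = 1 \/ s = -1 -> M <= b ->
  (\int[mu]_(x in oriented_itv s M b) ((h x - h x0) ^+ 2)%:E <= (tail_const * E)%:E)%E.
Proof.
move=> ed lh sh T0 Te x0M s1 Mb.
have me := ed_meas _ _ _ _ ed; have E0 := ed_E0 _ _ _ _ ed.
have tV := tails _ s1; have mO1 := measurable_oriented_itv s M b s1.
have lW x : M - 2 <= s * x <= b + 2 -> lipschitz_near V x by move=> /andP[/tV[]].
have dW x : M <= s * x <= b -> derivable V x 1 /\ c <= s * V^`()%classic x.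
  by move=> /andP[Mx _]; have [|? _ _ _ []] := tV x; first by lra.
have WP := @weighted_poincare R s M b c (h x0) V h T e s1 Mb c0 lW dW lh sh T0 Te me.
have k0 : 0 <= 2 / c by rewrite divr_ge0// ltW.
have I1 := energy_leb _ _ _ _ _ _ ed mO1 k0.
have osc := interior_osc _ _ _ _ _ _ _ _ ed lh sh T0 Te x0M (norm_signM_le s s1).
have mg : mfun (oriented_itv s M b) (fun x => (h x - h x0) ^+ 2).
  apply: measurable_funTS; apply: lipschitz_near_mfun => x.
  by apply: lipschitz_nearM; (apply: lipschitz_nearD; [exact: lh|exact: lipschitz_near_cst]).
have g0 x : 0 <= (h x - h x0) ^+ 2 by exact: sqr_ge0.
have c20 : 0 < c / 2 by rewrite divr_gt0.
have Lc : ((c / 2)%:E * \int[mu]_(x in oriented_itv s M b) ((h x - h x0) ^+ 2)%:E <=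
    ((osc_const * expR BV + 2 / c) * E)%:E)%E.
  rewrite -mu_integralZl ?(ltW c20)// mu_density//; first last.
  - by move=> x; rewrite mulr_ge0// ltW.
  - exact: measurable_funM.
  have B0 : (0 <= ((h (s * b) - h x0) ^+ 2 * expR (- V (s * b)))%:E)%E.
    by rewrite lee_fin mulr_ge0// expR_ge0.
  apply: le_trans (leeDr _ B0) _; apply: (le_trans WP).
  rewrite [X in (_ <= X%:E)%E]mulrDl EFinD; apply: leeD => //.
  by rewrite lee_fin [leRHS]mulrAC; apply: ler_pM; rewrite ?sqr_ge0 ?expR_ge0 ?expRN_bnd ?osc ?norm_signM_le.
rewrite /tail_const -mulrA EFinM lee_pdivlMl//.
Qed.

Lemma poincare_trunc f S e E (k : R) x0 : energy_data f S e E -> 0 < k -> `|x0| <= M ->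
  (\int[mu]_x ((Num.max (f x) k - Num.max (f x0) k) ^+ 2)%:E <= ((osc_const + tail_const + tail_const) * E)%:E)%E.
Proof.
move=> ed k0 x0M; have [T [lh sh T0 _ Te]] := truncation _ _ _ _ _ ed k0.
have E0 := ed_E0 _ _ _ _ ed.
have lg x : lipschitz_near (fun x => (Num.max (f x) k - Num.max (f x0) k) ^+ 2) x.
  by apply: lipschitz_nearM; (apply: lipschitz_nearD; [exact: lh|exact: lipschitz_near_cst]).
have mg := lipschitz_near_mfun _ lg.
rewrite !mulrDl; apply: (integral_pieces mu _ M _ _ M0 mg) => [x||].
- exact: sqr_ge0.
- have mO1 := measurable_oriented_itv 1 (- M) M (or_introl erefl).
  apply: (@le_trans _ _ (\int[mu]_(x in oriented_itv 1 (- M) M) (osc_const * E)%:E)%E).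
    apply: (@ge0_le_integral _ (measurableTypeR R) R mu _ mO1).
    + by move=> x _; rewrite lee_fin sqr_ge0.
    + apply/mfun_EFinP; exact: measurable_funTS.
    + exact: measurable_cst.
    + move=> x; rewrite /oriented_itv/= mul1r -ler_norml => xM; rewrite lee_fin.
      exact: interior_osc ed lh sh T0 Te x0M xM.
  rewrite integral_cst// -[leRHS]mule1 lee_wpmul2l ?lee_fin ?mulr_ge0 ?osc_const_ge0//.
  exact: probability_le1.
- by move=> s b s1 Mb; exact: tail_poincare ed lh sh T0 Te x0M s1 Mb.
Qed.

(** The bound for [max(f, k)] has a constant independent of [k], and truncation moves [f x - f x0]
    by at most [k]. The choice [2 k^2 = eps] and [(u + v)^2 <= 2 u^2 + 2 v^2] give the claim up to
    [eps]; the latter explains the [2] in [poincare_const]. *)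
Lemma poincare f S e E x0 : energy_data f S e E -> `|x0| <= M ->
  (\int[mu]_x ((f x - f x0) ^+ 2)%:E <= (poincare_const * E)%:E)%E.
Proof.
move=> ed x0M; have lf := ed_lip _ _ _ _ ed.
apply/lee_addgt0Pr => eps eps0.
pose k := Num.sqrt (eps / 2).
have k0 : 0 < k by rewrite sqrtr_gt0 divr_gt0.
have kE : 2 * k ^+ 2 = eps by rewrite sqr_sqrtr ?divr_ge0 ?ltW//; field.
have [T [lh _ _ _ _]] := truncation _ _ _ _ _ ed k0.
pose g x := (Num.max (f x) k - Num.max (f x0) k) ^+ 2.
have mg : mfun setT g.
  apply: lipschitz_near_mfun => x.
  by apply: lipschitz_nearM; (apply: lipschitz_nearD; [exact: lh|exact: lipschitz_near_cst]).
have mT : @measurable _ (measurableTypeR R) setT by exact: measurableT.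
have g0 x : 0 <= g x by exact: sqr_ge0.
apply: (@le_trans _ _ (\int[mu]_x (2 * g x + eps)%:E)%E).
  apply: (@ge0_le_integral _ (measurableTypeR R) R mu _ mT).
  - by move=> x _; rewrite lee_fin sqr_ge0.
  - apply/mfun_EFinP; apply: lipschitz_near_mfun => x.
    by apply: lipschitz_nearM; (apply: lipschitz_nearD; [exact: lf|exact: lipschitz_near_cst]).
  - apply/mfun_EFinP; apply: measurable_funD => //; exact: measurable_funM.
  - move=> x _; rewrite lee_fin -kE /g.
    have dist y : 0 <= Num.max (f y) k - f y <= k.
      have fy := ed_f0 _ _ _ _ ed y.
      by have [fk|kf] := leP (f y) k; move: k0 fy; lra.
    have := dist x; have := dist x0.
    move: (Num.max (f x) k) (Num.max (f x0) k) => u u0 d0 d1.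
    have : (f x - f x0) ^+ 2 <= 2 * (u - u0) ^+ 2 + 2 * ((u - f x) - (u0 - f x0)) ^+ 2.
      rewrite -subr_ge0.
      have -> : 2 * (u - u0) ^+ 2 + 2 * ((u - f x) - (u0 - f x0)) ^+ 2 - (f x - f x0) ^+ 2 =
        ((u - u0) + ((u - f x) - (u0 - f x0))) ^+ 2 by ring.
      exact: sqr_ge0.
    move=> /le_trans; apply; rewrite lerD2l ler_pM2l//.
    rewrite -(real_normK (num_real (_ - _))) ler_pXn2r ?nnegrE ?(ltW k0)//.
    by rewrite ler_norml; move: d0 d1; lra.
under eq_integral do rewrite EFinD.
rewrite ge0_integralD//; first last.
- by move=> x _; rewrite lee_fin ltW.
- apply/mfun_EFinP; exact: measurable_funM.
- by move=> x _; rewrite lee_fin mulr_ge0.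
have -> : (\int[mu]_x eps%:E = eps%:E)%E.
  by rewrite integral_cst// [X in (_ * X)%E]probability_setT mule1.
rewrite mu_integralZl// leeD2r//.
rewrite /poincare_const -mulrA EFinM lee_wpmul2l// ?lee_fin//.
exact: poincare_trunc ed k0 x0M.
Qed.

Lemma mu_integral_sub (D : set (measurableTypeR R)) (g : R -> R) :
  measurable D -> mfun setT g -> (forall x, 0 <= g x) ->
  (\int[mu]_(x in D) (g x)%:E <= \int[mu]_x (g x)%:E)%E.
Proof.
move=> mD mg g0; have mT : @measurable _ (measurableTypeR R) setT by exact: measurableT.
apply: (@ge0_subset_integral _ _ _ mu D setT mD mT (fun x => (g x)%:E)) => //.
  exact/mfun_EFinP.
by move=> x _; rewrite lee_fin.
Qed.

Lemma mu_integral_le (D : set (measurableTypeR R)) (g1 g2 : R -> R) :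
  measurable D -> mfun D g1 -> mfun D g2 -> (forall x, 0 <= g1 x) ->
  (forall x, D x -> g1 x <= g2 x) ->
  (\int[mu]_(x in D) (g1 x)%:E <= \int[mu]_(x in D) (g2 x)%:E)%E.
Proof.
move=> mD m1 m2 g10 g12; apply: (@ge0_le_integral _ (measurableTypeR R) R mu _ mD).
- by move=> x _; rewrite lee_fin.
- exact/mfun_EFinP.
- exact/mfun_EFinP.
- by move=> x Dx; rewrite lee_fin g12.
Qed.

(** Otherwise [int f^2] over the centre alone would exceed [1]. At such a point [max(f, K)] equals
    [K], which anchors the oscillation bounds at the truncation level. *)
Lemma small_point f (K : R) : (forall x, lipschitz_near f x) -> (forall x, 0 <= f x) -> 0 <= K ->
  (1 < (K ^+ 2)%:E * mu (oriented_itv 1 (- M) M))%E ->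
  (\int[mu]_x (f x ^+ 2)%:E = 1)%E -> exists2 x, `|x| <= M & f x <= K.
Proof.
move=> lf f0 K0 KM f1; apply: contrapT => /forall2NP noK.
have mf2 : mfun setT (fun x => f x ^+ 2) by apply: lipschitz_near_mfun => x; exact: lipschitz_nearM.
have mO1 := measurable_oriented_itv 1 (- M) M (or_introl erefl).
have : (\int[mu]_(x in oriented_itv 1 (- M) M) (K ^+ 2)%:E <= 1)%E.
  rewrite -f1; apply: le_trans (mu_integral_sub _ _ mO1 mf2 _); last by move=> x; exact: sqr_ge0.
  apply: mu_integral_le => //; first exact: measurable_funTS.
    by move=> _; exact: sqr_ge0.
  move=> x; rewrite /oriented_itv/= mul1r -ler_norml => xM.
  have [//|/negP] := noK x; rewrite -ltNge => Kf.
  by rewrite ler_pXn2r ?nnegrE// ltW.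
by rewrite integral_cst// leNgt KM.
Qed.

(** What remains after [tail_estimate] is the boundary term at [s * M]. It contains
    [h^2 Phi(V'(1 - K/h))], at most [(h - K)^2 Phi(V')], and [K = h x0] makes this a squared
    oscillation over the centre. *)
Lemma tail_energy (K : R) : 0 < K -> exists2 C5 : R, 0 <= C5 &
  forall f S e E x0 (s b : R), energy_data f S e E -> `|x0| <= M -> f x0 <= K ->
    s = 1 \/ s = -1 -> M <= b ->
    (\int[mu]_(x in oriented_itv s M b)
      (Phi (tail_arg V (fun x => Num.max (f x) K) s K x) * Num.max (f x) K ^+ 2)%:E <=
     (C5 * E)%:E)%E.
Proof.
move=> K0; have [Ct Ct0 TE] := tail_estimate Phg q q0 qth.
pose d := (1 - q * theta) / 2.
have d0 : 0 < d by rewrite divr_gt0// subr_gt0.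
pose vM s := s * V^`()%classic (s * M).
pose G s := Phi (vM s) * ((vM s)^-1 * expR (- V (s * M))).
have vM0 s : s = 1 \/ s = -1 -> 0 < vM s.
  move=> s1; have [|_ _ _ _ [cV _]] := tails _ s1 (s * M); last exact: lt_le_trans cV.
  by rewrite mulrA sign_mulKself// mul1r; lra.
have G0 s : s = 1 \/ s = -1 -> 0 <= G s.
  move=> s1; rewrite mulr_ge0 ?(young_ge0 Phg)// mulr_ge0 ?expR_ge0// invr_ge0 ltW// vM0//.
have G1 := G0 1 (or_introl erefl); have GN1 := G0 (-1) (or_intror erefl).
exists (d^-1 * (osc_const * (G 1 + G (-1)) + Ct)).
  by rewrite mulr_ge0 ?invr_ge0 ?(ltW d0)// addr_ge0// mulr_ge0 ?osc_const_ge0// addr_ge0.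
move=> f S e E x0 s b ed x0M fx0 s1 Mb.
have [T [lh sh T0 HT Te]] := truncation _ _ _ _ _ ed K0.
set h := fun x => Num.max (f x) K in lh sh HT *.
have Kh x : K <= h x by rewrite /h le_max lexx orbT.
have h0 x : 0 < h x by rewrite (lt_le_trans K0).
have tV := tails _ s1; have mO1 := measurable_oriented_itv s M b s1; have E0 := ed_E0 _ _ _ _ ed.
have me := ed_meas _ _ _ _ ed.
have {TE} TE := TE V h T e s M c b K s1 Mb c0 tV K0 lh sh T0 Kh HT me.
set z := tail_arg V h s K in TE *.
have lz x : M <= s * x <= b -> lipschitz_near z x.
  by move=> /andP[Mx _]; apply: tail_arg_lipschitz_near tV _ (lh x) _; [lra|rewrite gt_eqF].
have mg : mfun (oriented_itv s M b) (fun x => Phi (z x) * h x ^+ 2).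
  apply: mfun_oriented_itv => // x xMb; apply: lipschitz_near_cont; apply: lipschitz_nearM; last exact: lipschitz_nearM.
  by apply: (@lipschitz_near_comp R Phi z); [exact: lz|exact: young_lipschitz_near Phg _].
have g0 x : 0 <= Phi (z x) * h x ^+ 2.
  by rewrite mulr_ge0 ?sqr_ge0// (young_ge0 Phg).
rewrite -mulrA EFinM lee_pdivlMl// -mu_integralZl ?(ltW d0)// mu_density//; first last.
- by move=> x; rewrite mulr_ge0// ltW.
- exact: measurable_funM.
under eq_integral do rewrite mulrA.
apply: (le_trans TE).
rewrite [X in (_ <= X%:E)%E]mulrDl EFinD; apply: leeD; last exact: energy_leb ed mO1 Ct0.
rewrite lee_fin.
have hx0 : h x0 = K by rewrite /h max_r.
have osc := interior_osc _ _ _ _ _ _ _ _ ed lh sh T0 Te x0M (norm_signM_le s s1).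
rewrite hx0 in osc.
set y := s * M in osc *.
have p0 : 0 <= 1 - K / h y by rewrite subr_ge0 ler_pdivrMr// mul1r.
have p1 : 1 - K / h y <= 1 by rewrite gerBl divr_ge0// ltW.
(* The quadratic gain for factors at most [1] is essential: after multiplication by [h^2] it leaves
   exactly [(h - K)^2]. *)
have Pz : Phi (z y) <= (1 - K / h y) ^+ 2 * Phi (vM s).
  rewrite /z /tail_arg -/(vM s) mulrC; apply: (young_scale_le1 Phg) => //.
  by rewrite ltW// vM0.
rewrite (@le_trans _ _ ((h y - K) ^+ 2 * G s))//.
  have -> : (h y - K) ^+ 2 * G s = (1 - K / h y) ^+ 2 * Phi (vM s) *
      (h y ^+ 2 * ((vM s)^-1 * expR (- V y))).
    by rewrite /G -/y; field; rewrite !gt_eqF// vM0.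
  rewrite ler_wpM2r//; apply: mulr_ge0; first exact: sqr_ge0.
  by rewrite mulr_ge0 ?expR_ge0// invr_ge0 ltW// vM0.
rewrite (@le_trans _ _ (osc_const * E * G s))//; first by rewrite ler_wpM2r ?G0.
rewrite mulrAC ler_wpM2r// ler_wpM2l ?osc_const_ge0//.
by case: s1 => ->; rewrite ?lerDl ?lerDr.
Qed.

Lemma max_growth f S e E (K : R) x0 : energy_data f S e E -> 1 <= K ->
  `|x0| <= M -> f x0 <= K ->
  (forall x, `|x| <= M -> f x <= (K + 2 + osc_const + c^-1) * (1 + E) * expR 0) /\
  (forall (s x : R), s = 1 \/ s = -1 -> M <= s * x ->
     f x <= (K + 2 + osc_const + c^-1) * (1 + E) * expR (Num.max (V x) 0)).
Proof.
move=> ed K1 x0M fx0; have K0 := lt_le_trans ltr01 K1.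
have [T [lh sh T0 HT Te]] := truncation _ _ _ _ _ ed K0.
set h := fun x => Num.max (f x) K in lh sh HT *.
have E0 := ed_E0 _ _ _ _ ed; have C10 := osc_const_ge0.
have ci0 : 0 <= c^-1 by rewrite invr_ge0 ltW.
have fh x : f x <= h x by rewrite /h le_max lexx.
have C1E : 0 <= osc_const * E by rewrite mulr_ge0.
have ciE : 0 <= c^-1 * E by rewrite mulr_ge0.
have KE : 0 <= K * E by rewrite mulr_ge0// ltW.
have hint x : `|x| <= M -> h x <= K + 1 + osc_const * E.
  move=> xM; have := interior_osc _ _ _ _ _ _ _ _ ed lh sh T0 Te x0M xM.
  rewrite {2}/h max_r// => osc.
  (* This is [t <= t^2 + 1/4] for [t = h x - K]: it makes the bound linear in [E] rather than in its
     square root. *)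
  have : 0 <= (h x - K - 2^-1) ^+ 2 by exact: sqr_ge0.
  have -> : (h x - K - 2^-1) ^+ 2 = (h x - K) ^+ 2 - (h x - K) + 4^-1 by field.
  by move: osc; move: (_ ^+ 2) => ?; lra.
split=> [x xM|s x s1 Mx].
  rewrite expR0 mulr1 (le_trans (fh x))// (le_trans (hint x xM))//.
  by rewrite mulrDr mulr1 !mulrDl; lra.
have tV := tails _ s1.
have lV y : M - 2 <= s * y <= s * x + 2 -> lipschitz_near V y by move=> /andP[/tV[]].
have dV y : M <= s * y <= s * x -> derivable V y 1 /\ c <= s * V^`()%classic y.
  by move=> /andP[My _]; have [|? _ _ _ []] := tV y; first by lra.
have EG := @exp_growth R s M (s * x) c V h T e s1 Mx c0 lV dV lh sh T0 Te (ed_meas _ _ _ _ ed).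
have half0 : 0 <= 2^-1 :> R by [].
have I1 := energy_leb _ _ _ _ _ _ ed (measurable_oriented_itv s M (s * x) s1) half0.
rewrite mulrA sign_mulKself// mul1r in EG.
have {EG} := le_trans EG (leeD (lexx _) I1); rewrite -EFinD lee_fin => EG.
have hs := hint _ (norm_signM_le s s1).
have P0 : 1 <= expR (Num.max (V x) 0) by rewrite -[leLHS]expR0 ler_expR le_max lexx orbT.
have PV : expR (V x) <= expR (Num.max (V x) 0) by rewrite ler_expR le_max lexx.
have cP : c^-1 * expR (V x) <= c^-1 * expR (Num.max (V x) 0) by rewrite ler_wpM2l.
move: EG P0 cP {PV}; move: (expR (V x)) (expR (Num.max (V x) 0)) => u P EG P1 cP.
apply: (le_trans (fh x)); apply: (le_trans EG).
have A0 : 0 <= K + 1 + osc_const * E + 2^-1 * E by lra.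
have h1 : K + 1 + osc_const * E + 2^-1 * E <= (K + 1 + osc_const * E + 2^-1 * E) * P.
  by rewrite ler_peMr.
rewrite (@le_trans _ _ ((K + 1 + osc_const * E + 2^-1 * E) * P + c^-1 * P))//.
  by move: hs h1 cP; lra.
rewrite -mulrDl ler_wpM2r ?(le_trans ler01 P1)//.
by rewrite mulrDr mulr1 !mulrDl; lra.
Qed.

Lemma entropy_normalized (K : R) : 1 <= K ->
  (1 < (K ^+ 2)%:E * mu (oriented_itv 1 (- M) M))%E ->
  exists2 kappa : R, 0 <= kappa & forall f S e E, energy_data f S e E ->
    (\int[mu]_x (f x ^+ 2)%:E = 1)%E ->
    (\int[mu]_x (ent_density (f x))%:E <= (kappa * E)%:E)%E.
Proof.
move=> K1 KM; have K0 := lt_le_trans ltr01 K1.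
have [C5 C50 TE] := tail_energy K K0.
pose C6 := K + 2 + osc_const + c^-1.
have C61 : 1 <= C6.
  have := osc_const_ge0; have : 0 <= c^-1 by rewrite invr_ge0 ltW.
  by rewrite /C6; lra.
pose C7 := 4 * K + 1 + 8 * ln C6.
have C70 : 0 <= C7 by have := ln_ge0 C61; rewrite /C7; lra.
(* The [2] comes from [2 P y^2] in [ent_density_growth], [CV] from [V <= CV Phi(V')], and [2^theta]
   from replacing [V'] by [V'/2]. *)
pose C8 := 2 * (CV * 2 `^ theta).
have C80 : 0 <= C8 by rewrite mulr_ge0// mulr_ge0// powR_ge0.
(* The first term is the cost of [(f - 1)^2] through [variance_bound] and [poincare]; the final [2]
   is the integral of [2 E f^2], divided by [E]. *)
pose a0 := C7 * (2 * poincare_const) + 2.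
have a00 : 0 <= a0 by rewrite addr_ge0// mulr_ge0// mulr_ge0// poincare_const_ge0.
pose a1 := a0 + C8 * C5.
have a10 : 0 <= a1 by rewrite addr_ge0// mulr_ge0.
exists (a0 + a1 + a1); first by apply: addr_ge0 => //; exact: addr_ge0.
move=> f S e E ed f1; have lf := ed_lip _ _ _ _ ed; have f0 := ed_f0 _ _ _ _ ed.
have E0 := ed_E0 _ _ _ _ ed.
have [x0 x0M fx0] := small_point f K lf f0 (ltW K0) KM f1.
have [grI grT] := max_growth _ _ _ _ _ _ ed K1 x0M fx0.
have mf := lipschitz_near_mfun _ lf.
have mf2 : mfun setT (fun x => f x ^+ 2) by exact: measurable_funM.
have ment : mfun setT (fun x => ent_density (f x)).
  apply: measurable_funD => //; apply: measurable_funB => //.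
  apply: measurable_funM => //.
  exact: (measurableT_comp (@measurable_ln R) mf2).
pose g x := C7 * (f x - 1) ^+ 2 + 2 * E * f x ^+ 2.
have mf12 : mfun setT (fun x => (f x - 1) ^+ 2).
  by apply: measurable_funM; apply: measurable_funB.
have mg : mfun setT g.
  by apply: measurable_funD; apply: measurable_funM.
have g0 x : 0 <= g x.
  by rewrite addr_ge0// mulr_ge0 ?sqr_ge0// mulr_ge0.
have Ig : (\int[mu]_x (g x)%:E <= (a0 * E)%:E)%E.
  have mT : @measurable _ (measurableTypeR R) setT by exact: measurableT.
  under eq_integral do rewrite EFinD.
  rewrite ge0_integralD//; first last.
  - by apply/mfun_EFinP; apply: measurable_funM.
  - by move=> x _; rewrite lee_fin mulr_ge0 ?sqr_ge0// mulr_ge0.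
  - by apply/mfun_EFinP; apply: measurable_funM.
  - by move=> x _; rewrite lee_fin mulr_ge0 ?sqr_ge0.
  rewrite !mu_integralZl// ?mulr_ge0//; try by move=> x; exact: sqr_ge0.
  rewrite f1 mule1 /a0 [X in (_ <= X%:E)%E]mulrDl [X in (_ <= X)%E]EFinD leeD2r//.
  rewrite -mulrA EFinM lee_wpmul2l ?lee_fin//.
  rewrite (le_trans (variance_bound mu f (f x0) mf f0 f1))//.
  rewrite -mulrA EFinM lee_wpmul2l ?lee_fin//.
  exact: poincare ed x0M.
have IgD (D : set (measurableTypeR R)) : measurable D ->
    (\int[mu]_(x in D) (g x)%:E <= (a0 * E)%:E)%E.
  by move=> mD; apply: le_trans Ig; exact: mu_integral_sub.
rewrite (mulrDl (a0 + a1)) (mulrDl a0 a1); apply: (integral_pieces mu _ M _ _ M0 ment) => [x||].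
- exact: ent_density_ge0.
- have mO1 := measurable_oriented_itv 1 (- M) M (or_introl erefl).
  apply: le_trans (IgD _ mO1); apply: mu_integral_le => //.
  + exact: measurable_funTS.
  + exact: measurable_funTS.
  + by move=> x; exact: ent_density_ge0.
  move=> x; rewrite /oriented_itv/= mul1r -ler_norml => xM.
  have := @ent_density_growth R (f x) K E C6 0 (f0 x) K1 E0 C61 (grI x xM).
  by rewrite mulr0 mul0r; case: ifP => _; rewrite addr0.
move=> s b s1 Mb; have mO1 := measurable_oriented_itv s M b s1.
have {TE} TE := TE f S e E x0 s b ed x0M fx0 s1 Mb.
set h := fun x => Num.max (f x) K in TE.
set z := tail_arg V h s K in TE.
have tV := tails _ s1.
have Kh x : K <= h x by rewrite /h le_max lexx orbT.
have h0 x : 0 < h x by rewrite (lt_le_trans K0).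
have mz : mfun (oriented_itv s M b) (fun x => Phi (z x) * h x ^+ 2).
  have [T [lh _ _ _ _]] := truncation _ _ _ _ _ ed K0.
  apply: mfun_oriented_itv => // x /andP[Mx _]; apply: lipschitz_near_cont; apply: lipschitz_nearM; last by apply: lipschitz_nearM; exact: lh.
  apply: (@lipschitz_near_comp R Phi z); last exact: young_lipschitz_near Phg _.
  by apply: (tail_arg_lipschitz_near V h _ _ _ _ K x tV _ (lh x)); [lra|rewrite gt_eqF].
have z0 x : 0 <= Phi (z x) * h x ^+ 2 by rewrite mulr_ge0 ?sqr_ge0// (young_ge0 Phg).
apply: (@le_trans _ _ (\int[mu]_(x in oriented_itv s M b) (g x + C8 * (Phi (z x) * h x ^+ 2))%:E)%E).
  apply: mu_integral_le => //.
  + exact: measurable_funTS.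
  + by apply: measurable_funD; [exact: measurable_funTS|exact: measurable_funM].
  + by move=> x; exact: ent_density_ge0.
  move=> x /andP[Mx _].
  have P0 : 0 <= Num.max (V x) 0 by rewrite le_max lexx orbT.
  have := @ent_density_growth R (f x) K E C6 _ (f0 x) K1 E0 C61 (grT s x s1 Mx).
  move=> /le_trans; apply; rewrite /g lerD2l; case: ifPn => [Kf|_]; last by rewrite mulr_ge0.
  have hf : h x = f x by rewrite /h max_l//; lra.
  have [|_ _ _ _ [cV _]] := tV x; first by lra.
  set v := s * V^`()%classic x in cV.
  have v0 : 0 < v by rewrite (lt_le_trans c0).
  (* Here [f x > 2K], so the argument of the tail estimate is at least [v / 2], and the [theta]
     growth of [Phi] recovers [Phi v]. *)
  have Pv : Phi v <= 2 `^ theta * Phi (z x).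
    have -> : v = 2 * (v / 2) by field.
    rewrite (le_trans (young_scale_ge1 Phg _ _ _ _))//; [lra|lra|].
    rewrite ler_wpM2l ?powR_ge0// (young_mono Phg)//; first lra.
    rewrite /z /tail_arg -/v ler_wpM2l ?(ltW v0)// hf.
    have : K / f x <= 2^-1 by rewrite ler_pdivrMr; lra.
    by move: (K / f x) => ?; lra.
  have Vle : Num.max (V x) 0 <= CV * (2 `^ theta * Phi (z x)).
    rewrite ge_max (le_trans (V_Phi s x s1 Mx))/=; last by rewrite ler_wpM2l.
    by rewrite mulr_ge0// mulr_ge0 ?powR_ge0// (young_ge0 Phg).
  rewrite hf mulrA ler_wpM2r ?sqr_ge0// /C8 -!mulrA ler_pM2l//.
under eq_integral do rewrite EFinD.
rewrite ge0_integralD//; first last.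
- by apply/mfun_EFinP; apply: measurable_funM.
- by move=> x _; rewrite lee_fin mulr_ge0.
- by apply/mfun_EFinP; exact: measurable_funTS.
- by move=> x _; rewrite lee_fin.
rewrite mu_integralZl// /a1 [X in (_ <= X%:E)%E]mulrDl [X in (_ <= X)%E]EFinD.
apply: leeD; first exact: IgD.
by rewrite -(mulrA C8) [X in (_ <= X)%E]EFinM lee_wpmul2l ?lee_fin.
Qed.

End entropy_energy.

(** * The hypotheses at infinity *)

Section hypotheses_at_infinity.
Context {R : realType}.
Implicit Types (f V Phi : R -> R) (u : R -> \bar R).

Lemma ereal_between (x y : \bar R) : (x < y)%E -> exists r : R, (x < r%:E)%E /\ (r%:E < y)%E.
Proof.
case: x => [x| |]; case: y => [y| |] //=.
- rewrite lte_fin => xy; exists ((x + y) / 2); rewrite !lte_fin; lra.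
- by move=> _; exists (x + 1); rewrite lte_fin ltry ltrDl.
- by move=> _; exists (y - 1); rewrite lte_fin ltNyr; split => //; rewrite ltrBlDr ltrDl.
- by move=> _; exists 0; rewrite ltry ltNyr.
Qed.

Lemma limf_esup_abs_infty u (y : \bar R) : (limf_esup u (@abs_infty R) < y)%E ->
  exists M : R, forall x, M < `|x| -> (u x < y)%E.
Proof.
move=> /ereal_inf_lt[_ [A [M _ MA] <-]] Ay; exists M => x Mx.
by rewrite (le_lt_trans _ Ay)//; apply: ereal_sup_ubound; exists x => //; exact: MA.
Qed.

Lemma limf_einf_abs_infty u (y : \bar R) : (y < limf_einf u (@abs_infty R))%E ->
  exists M : R, forall x, M < `|x| -> (y < u x)%E.
Proof.
rewrite /limf_einf lteNr => /limf_esup_abs_infty[M HM].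
by exists M => x /HM; rewrite lteN2.
Qed.

Lemma sg_mul_gt (s x M : R) : 0 <= M -> s = 1 \/ s = -1 -> M < s * x ->
  M < `|x| /\ Num.sg x = s.
Proof.
move=> M0 [->|->]; rewrite ?mul1r ?mulN1r => Mx.
  by rewrite gtr0_norm ?gtr0_sg// (le_lt_trans M0).
have x0 : x < 0 by rewrite -oppr_gt0 (le_lt_trans M0).
by rewrite ltr0_norm ?ltr0_sg.
Qed.

Lemma derivable_continuous_at (g : R -> R) (x : R) :
  derivable g x 1 -> {for x, continuous g}.
Proof. by move=> /derivable1_diffP dg; exact: differentiable_continuous dg. Qed.

Lemma C2_lipschitz_near V : C2_near_infty V -> exists M : R, forall x, M < `|x| ->
  [/\ derivable V x 1, lipschitz_near V x, derivable V^`()%classic x 1 & lipschitz_near V^`()%classic x].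
Proof.
move=> [M _ HM]; exists M => x Mx; have [d1 d2 c2] := HM x Mx.
have nearx : \forall y \near x, M < `|y|.
  by apply: (cvgr_gt _ (cvg_norm (@cvg_id _ (nbhs x)))).
split => //; apply: lipschitz_near_C1.
- by move: nearx; apply: filterS => y /HM[d _ _]; exact: d.
- exact: derivable_continuous_at d2.
- by move: nearx; apply: filterS => y /HM[_ d _]; exact: d.
- exact: c2.
Qed.

Lemma locally_bounded_itv V (M : R) : locally_bounded V ->
  exists B : R, forall x, `|x| <= M -> `|V x| <= B.
Proof.
move=> bV; have /compact_near_coveringP := @segment_compact R (- M) M.
move=> /(_ R (+oo)%R (fun B x => `|V x| <= B) _).
case => [x' _|B [Breal HB]]; last first.
  exists (B + 1) => x xM; apply: (HB (B + 1)); first by rewrite ltrDl.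
  by rewrite /= in_itv/= -ler_norml.
move: (x' : R) => {x'} x.
have [B [_ HB]] := bV x.
exists ([set y | `|V y| <= B + 1], [set b | B + 1 <= b]).
  split => /=; first by apply: HB; rewrite ltrDl.
  by exists (B + 1); split; [exact: num_real|move=> b /ltW].
by move=> [y b] /= [yB Bb]; rewrite (le_trans yB).
Qed.

End hypotheses_at_infinity.

(** * A measurable substitute for the local slope *)

Section sequential_slope.
Context {R : realType}.
Implicit Types (f : R -> R) (x : R).
Local Notation mfun D f := (@measurable_fun _ _ (measurableTypeR R) R D f).

Lemma locally_lipschitz_lipschitz_near f x : locally_lipschitz f -> lipschitz_near f x.
Proof.
move=> /(_ x)[U /nbhs_ballP[r /= r0 rU] [k [_ kf]]].
(* The library predicate holds for all constants beyond [k]; [k + 1] is one of them, and the maximum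
   makes it nonnegative. *)
pose C := Num.max 0 (k + 1).
have kC : k < C by rewrite lt_max ltrDl ltr01 orbT.
exists C, r; split => //; first by rewrite le_max lexx.
move=> y z yx zx; apply: (kf C kC (y, z)); split => /=; apply: rU.
  by rewrite /ball/= distrC.
by rewrite /ball/= distrC.
Qed.

(** The least admissible error in [slope f x 0 _]. It is a limit superior of countably many
    continuous functions of [x], hence measurable, whereas [abs_deriv] takes suprema over
    uncountably many points. *)
Definition seq_slope f x : \bar R := limn_esup (fun n => (`|diff_quot f x n|)%:E).

Lemma seq_slope_ge0 f x : (0 <= seq_slope f x)%E.
Proof.
apply: limf_esup_ge0; last by move=> n; rewrite lee_fin.
by move=> [n _ /(_ n (leqnn n))].
Qed.

Lemma diff_quot_lipschitz_near f x (C r : R) : 0 <= C -> 0 < r ->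
  (forall y z, `|y - x| < r -> `|z - x| < r -> `|f y - f z| <= C * `|y - z|) ->
  \forall n \near \oo, `|diff_quot f x n| <= C.
Proof.
move=> C0 r0 Cf.
have hn : \forall n \near \oo, n.+1%:R^-1 < r.
  have /cvgrPdist_lt/(_ _ r0) := @cvg_harmonic R.
  by apply: filterS => n; rewrite sub0r normrN /harmonic ger0_norm ?invr_ge0.
apply: filterS hn => n nr.
have n0 : 0 < n.+1%:R^-1 :> R by rewrite invr_gt0.
rewrite /diff_quot normrM (ger0_norm (ler0n _ _)) -ler_pdivlMr ?ltr0n//.
have xn : x + n.+1%:R^-1 - x = n.+1%:R^-1 by rewrite addrAC subrr add0r.
have := Cf (x + n.+1%:R^-1) x; rewrite xn subrr normr0 (gtr0_norm n0).
by apply.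
Qed.

Lemma seq_slope_fin f x : lipschitz_near f x -> seq_slope f x \is a fin_num.
Proof.
move=> [C [r [C0 r0 Cf]]]; rewrite ge0_fin_numE ?seq_slope_ge0//.
rewrite (@le_lt_trans _ _ C%:E) ?ltry//.
have [N _ NC] := diff_quot_lipschitz_near f x C r C0 r0 Cf.
apply: ereal_inf_le; exists (ereal_sup [set (`|diff_quot f x n|)%:E | n in [set n | (N <= n)%N]]).
  by exists [set n | (N <= n)%N] => //; exists N.
by apply: ge_ereal_sup => _ [n /= Nn <-]; rewrite lee_fin; exact: NC.
Qed.

Lemma slope_seq_slope f x : lipschitz_near f x -> slope f x 0 (fine (seq_slope f x)).
Proof.
move=> lf eta eta0.
have : (seq_slope f x < (fine (seq_slope f x) + eta)%:E)%E.
  by rewrite EFinD fineK ?seq_slope_fin// lteDl ?seq_slope_fin// lte_fin.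
move=> /ereal_inf_lt[_ [A [N _ NA] <-]] Ay; exists N => // n /= Nn.
rewrite subr0 -lee_fin ltW// (le_lt_trans _ Ay)//.
by apply: ereal_sup_ubound; exists n => //; exact: NA.
Qed.

Lemma measurable_seq_slope f : (forall x, lipschitz_near f x) -> mfun setT (fun x => fine (seq_slope f x)).
Proof.
move=> lf; apply/mfun_EFinP.
have -> : EFin \o (fun x => fine (seq_slope f x)) = seq_slope f.
  by apply/funext => x /=; rewrite fineK// seq_slope_fin.
apply: (@measurable_fun_limn_esup _ (measurableTypeR R)) => n.
apply/mfun_EFinP.
apply: continuous_measurable_fun => x.
have cf y : {for y, continuous f} by exact: lipschitz_near_cont (lf y).
by apply: cvg_norm; exact: diff_quot_continuous.
Qed.

(** The suprema [Q h] decrease with [h], so their limit at [0+] is an infimum; and the quotient at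
    [x + 1/(n+1)] competes in [Q h] as soon as [1/(n+1) <= h]. *)
Lemma seq_slope_le_abs_deriv f x : lipschitz_near f x -> fine (seq_slope f x) <= abs_deriv f x.
Proof.
move=> lf; have [C [r [C0 r0 Cf]]] := lf.
pose Q (h : R) : \bar R := ereal_sup [set (`|f x - f y| / `|x - y|)%:E
                        | y in [set y | 0 < `|x - y| <= h]].
have Qmono a b : a <= b -> (Q a <= Q b)%E.
  move=> ab; apply: le_ereal_sup => _ [y /= /andP[y0 ya] <-]; exists y => //=.
  by rewrite y0 (le_trans ya).
have QC h : h < r -> (Q h <= C%:E)%E.
  move=> hr; apply: ge_ereal_sup => _ [y /= /andP[y0 yh] <-].
  rewrite lee_fin ler_pdivrMr//; apply: Cf; rewrite ?subrr ?normr0//.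
  by rewrite distrC (le_lt_trans yh).
have Qdq n : ((`|diff_quot f x n|)%R%:E <= Q (n.+1%:R^-1)%R)%E.
  have n0 : 0 < n.+1%:R^-1 :> R by rewrite invr_gt0.
  have xn : `|x - (x + n.+1%:R^-1)| = n.+1%:R^-1 :> R.
    by rewrite opprD addrA subrr sub0r normrN gtr0_norm.
  apply: ereal_sup_ubound; exists (x + n.+1%:R^-1) => /=; first by rewrite xn n0 lexx.
  by rewrite xn invrK /diff_quot normrM distrC [`|n.+1%:R|]ger0_norm.
pose L := ereal_inf [set Q h | h in [set` `]0, r[ ]].
have QL : Q h @[h --> 0^'+] --> L.
  apply: (@nondecreasing_at_right_cvge _ Q 0 (BLeft r)); first by rewrite bnd_simp.
  by move=> a b _ _; exact: Qmono.
have sL : (seq_slope f x <= L)%E.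
  apply: le_ereal_inf_tmp => _ [h /= + <-]; rewrite in_itv/= => /andP[h0 hr].
  apply: ereal_inf_le.
  have /cvgrPdist_lt/(_ _ h0) := @cvg_harmonic R => -[N _ HN].
  exists (ereal_sup [set (`|diff_quot f x n|)%:E | n in [set n | (N <= n)%N]]).
    by exists [set n | (N <= n)%N] => //; exists N.
  apply: ge_ereal_sup => _ [n /= Nn <-]; apply: (le_trans (Qdq n)); apply: Qmono.
  have := HN n Nn; rewrite /= sub0r normrN ger0_norm; first exact: ltW.
  by rewrite /harmonic invr_ge0.
(* Finiteness of [L] matters: [fine] would send [+oo] to [0] and reverse the comparison. *)
have LC : (L <= C%:E)%E.
  apply: (@le_trans _ _ (Q (r / 2))); last by apply: QC; lra.
  by apply: ereal_inf_lbound; exists (r / 2) => //=; rewrite in_itv/=; apply/andP; split; lra.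
have absE : abs_deriv f x = fine L by rewrite /abs_deriv (cvg_lim _ QL).
rewrite absE fine_le// ?seq_slope_fin//.
by rewrite ge0_fin_numE ?(le_lt_trans LC) ?ltry// (le_trans (seq_slope_ge0 f x) sL).
Qed.

End sequential_slope.

(** [g] need not be measurable: the integral of a nonnegative function is a
  supremum over the simple functions below it. *)
Lemma ge0_le_integralT d (T : measurableType d) (R : realType)
    (mu : {measure set T -> \bar R}) (f g : T -> \bar R) :
  (forall x, 0 <= f x)%E -> (forall x, f x <= g x)%E ->
  (\int[mu]_x f x <= \int[mu]_x g x)%E.
Proof.
move=> f0 fg; have g0 x : (0 <= g x)%E := le_trans (f0 x) (fg x).
rewrite !ge0_integralTE//; apply: le_ereal_sup => _ [h hf <-].
by exists h => // x; exact: le_trans (hf x) (fg x).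
Qed.

(** * Normalisation of [f] and the entropy of [f^2] *)

Section scaled_functions.
Context {R : realType}.
Local Notation leb := (@lebesgue_measure R).
Local Notation mfun D f := (@measurable_fun _ _ (measurableTypeR R) R D f).

Lemma mu_itv_gt0 (V : R -> R) (mu : probability (measurableTypeR R) R) (M B : R) :
  has_density_expN mu V -> 0 < M -> (forall x, `|x| <= M -> `|V x| <= B) ->
  (0 < mu (oriented_itv 1 (- M) M))%E.
Proof.
move=> [mV muE] M0 VB.
have mO1 : @measurable _ (measurableTypeR R) (oriented_itv 1 (- M) M) by apply: measurable_oriented_itv; left.
rewrite muE//.
have mE : mfun setT (fun x => expR (- V x)).
  by apply: measurableT_comp => //; exact: measurableT_comp.
apply: (@lt_le_trans _ _ (\int[leb]_(x in oriented_itv 1 (- M) M) (expR (- B))%:E)%E).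
  have LE : (@lebesgue_measure R (oriented_itv 1 (- M) M) = (M + M)%:E)%E.
    rewrite oriented_itv1 lebesgue_measure_itv/= lte_fin.
    have -> : (- M < M) = true by lra.
    by rewrite -EFinD opprK.
  rewrite integral_cst// [X in (_ * X)%E]LE -EFinM lte_fin mulr_gt0 ?expR_gt0//; lra.
apply: (@ge0_le_integral _ (measurableTypeR R) R leb _ mO1).
- by move=> x _; rewrite lee_fin expR_ge0.
- exact: measurable_cst.
- by apply/mfun_EFinP; exact: measurable_funTS.
- move=> x; rewrite /oriented_itv/= mul1r -ler_norml => /VB; rewrite lee_fin ler_expR ler_norml.
  lra.
Qed.

Lemma exists_level (p : \bar R) : (0 < p)%E -> (p < +oo)%E ->
  exists2 K : R, 1 <= K & (1 < (K ^+ 2)%:E * p)%E.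
Proof.
case: p => [p| |]//; rewrite lte_fin => p0 _.
exists (1 + p^-1); first by rewrite lerDl invr_ge0 ltW.
rewrite -EFinM lte_fin.
have -> : (1 + p^-1) ^+ 2 * p = p + 2 + p^-1 by field; rewrite gt_eqF.
have : 0 < p^-1 by rewrite invr_gt0.
by move: (p^-1 : R) => ?; lra.
Qed.

Section scaling.
Context {Phi : R -> R} {theta : R} (Phg : young_growth Phi theta).
Context (mu : probability (measurableTypeR R) R).
Context (f : R -> R) (lf : forall x, lipschitz_near f x).
Local Notation H := (modification Phi).

Definition seq_energy x : R := H (fine (seq_slope f x) / f x) * f x ^+ 2.

Lemma seq_energy_ge0 x : 0 <= seq_energy x.
Proof. by rewrite mulr_ge0 ?sqr_ge0// (modification_ge0 Phg). Qed.

Lemma measurable_seq_energy : mfun setT seq_energy.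
Proof.
have mf := lipschitz_near_mfun _ lf.
apply: measurable_funM; last exact: measurable_funM.
(* [H] depends only on the absolute value of its argument, so the inverse of [f x] may be traded for
   a real power of [|f x|], whose measurability is at hand; both are [0] where [f] vanishes. *)
have -> : (fun x => H (fine (seq_slope f x) / f x)) =
    (fun x => H (fine (seq_slope f x) * `|f x| `^ (-1))).
  apply/funext => x; rewrite powR_inv1// /modification.
  rewrite -(real_normK (num_real (_ / f x))) -(real_normK (num_real (_ / `|f x|))).
  by rewrite !normrM !normfV normr_id.
apply: (measurable_modification Phg); apply: measurable_funM.
  exact: measurable_seq_slope.
apply: (measurableT_comp (@measurable_powR R (-1))).
exact: measurableT_comp.
Qed.

Lemma seq_energy_le : (\int[mu]_x (seq_energy x)%:E <= modified_energy Phi mu f)%E.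
Proof.
apply: ge0_le_integralT => x; first by rewrite lee_fin seq_energy_ge0.
rewrite lee_fin ler_wpM2r ?sqr_ge0// (modification_mono Phg)// !normrM ler_wpM2r//.
have s0 : 0 <= fine (seq_slope f x) by rewrite fine_ge0 ?seq_slope_ge0.
have sa := seq_slope_le_abs_deriv f x (lf x).
by rewrite !ger0_norm// (le_trans s0).
Qed.

(** The ratio of slope to value is unchanged by scaling, so the energy is homogeneous of degree two
    although [H] is not. *)
Lemma scaled_energy_data (r E : R) : 0 < r -> (\int[mu]_x (seq_energy x)%:E = E%:E)%E ->
  @energy_data R Phi mu (fun x => `|f x| / r) (fun x => fine (seq_slope f x) / r)
    (fun x => seq_energy x / r ^+ 2) (E / r ^+ 2).
Proof.
move=> r0 IE.
have s0 x : 0 <= fine (seq_slope f x) by rewrite fine_ge0 ?seq_slope_ge0.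
have r20 : 0 <= (r ^+ 2)^-1 by rewrite invr_ge0 sqr_ge0.
have dist y z : `| `|f y| / r - `|f z| / r| <= `|f y - f z| / r.
  rewrite -mulrBl normrM [`|r^-1|]gtr0_norm ?invr_gt0// ler_wpM2r ?invr_ge0 ?(ltW r0)//.
  exact: ler_dist_dist.
split.
- move=> x; have [C [d [C0 d0 Cf]]] := lf x.
  exists (C / r), d; split=> //; first by rewrite divr_ge0// ltW.
  move=> y z yx zx; rewrite (le_trans (dist y z))// [leRHS]mulrAC.
  by rewrite ler_wpM2r ?invr_ge0 ?(ltW r0)// Cf.
- move=> x eta eta0.
  have := slope_seq_slope f x (lf x) (eta * r) (mulr_gt0 eta0 r0).
  apply: filterS => n; rewrite !subr0 => dn.
  rewrite /diff_quot normrM (le_trans (ler_wpM2r _ (dist _ _)))//.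
  rewrite mulrAC -normrM -/(diff_quot f x n) ler_pdivrMr// mulrDl divfK ?gt_eqF//.
- by move=> x; rewrite divr_ge0// ltW.
- by move=> x; rewrite divr_ge0// ltW.
- move=> x; rewrite /seq_energy.
  have -> : fine (seq_slope f x) / r / (`|f x| / r) = fine (seq_slope f x) / `|f x|.
    have [->|f0] := eqVneq (f x) 0; first by rewrite normr0 mul0r invr0 !mulr0.
    by field; rewrite normr_eq0 f0 gt_eqF.
  rewrite exprMn real_normK ?num_real// exprVn mulrA ler_wpM2r// ler_wpM2r ?sqr_ge0//.
  by apply: (modification_mono Phg); rewrite !normrM !normfV normr_id.
- apply: measurable_funM => //; exact: measurable_seq_energy.
- under eq_integral do rewrite mulrC EFinM.
  rewrite ge0_integralZl_EFin//.
  + by rewrite IE -EFinM mulrC.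
  + by move=> x _; rewrite lee_fin seq_energy_ge0.
  + by apply/mfun_EFinP; exact: measurable_seq_energy.
Qed.

(** From [f^2 <= 2 (|f| - k)^2 + 2 k^2]. With [poincare] it shows that finite energy excludes the
    branch where the entropy is [+oo] by convention. *)
Lemma integrable_sqr (k a : R) : (\int[mu]_x ((`|f x| - k) ^+ 2)%:E <= a%:E)%E ->
  mu.-integrable setT (EFin \o (fun x => f x ^+ 2)).
Proof.
move=> Ia; have mf := lipschitz_near_mfun _ lf.
have mT : @measurable _ (measurableTypeR R) setT by exact: measurableT.
have mg : mfun setT (fun x => (`|f x| - k) ^+ 2).
  by apply: measurable_funM; apply: measurable_funB => //; exact: measurableT_comp.
have ig : mu.-integrable setT (EFin \o (fun x => (`|f x| - k) ^+ 2)).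
  apply/integrableP; split; first exact/mfun_EFinP.
  under eq_integral do rewrite /= ger0_norm ?sqr_ge0//.
  by rewrite (le_lt_trans Ia)// ltry.
have ic : mu.-integrable setT (EFin \o (fun=> 2 * k ^+ 2)) by exact: finite_measure_integrable_cst.
have i2g : mu.-integrable setT (EFin \o (fun x => 2 * (`|f x| - k) ^+ 2)).
  exact: (integrableZl mT _ ig).
apply: (@le_integrable _ _ _ _ _ mT _ (EFin \o (fun x => 2 * (`|f x| - k) ^+ 2 + 2 * k ^+ 2))).
- by apply/mfun_EFinP; exact: measurable_funM.
- move=> x _ /=; rewrite lee_fin ger0_norm ?sqr_ge0//.
  rewrite ger0_norm; last by rewrite addr_ge0// mulr_ge0// sqr_ge0.
  rewrite -(real_normK (num_real (f x))) -subr_ge0.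
  have -> : 2 * (`|f x| - k) ^+ 2 + 2 * k ^+ 2 - `|f x| ^+ 2 = (`|f x| - 2 * k) ^+ 2 by ring.
  exact: sqr_ge0.
- exact: (integrableD mT i2g ic).
Qed.

(** Pointwise, [f^2 ln f^2] is [m] times the density plus [(1 + ln m) f^2 - m], and the latter
    integrates to the subtracted [m ln m]. Finiteness of the density integral makes the splitting
    legitimate. *)
Lemma entropy_sqr (m : R) : mu.-integrable setT (EFin \o (fun x => f x ^+ 2)) ->
  (\int[mu]_x (f x ^+ 2)%:E = m%:E)%E -> 0 < m ->
  (\int[mu]_x (ent_density (`|f x| / Num.sqrt m))%:E < +oo)%E ->
  entropy mu (fun x => f x ^+ 2) =
    (m%:E * \int[mu]_x (ent_density (`|f x| / Num.sqrt m))%:E)%E.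
Proof.
move=> i2 Im m0 entoo; have mf := lipschitz_near_mfun _ lf.
have mT : @measurable _ (measurableTypeR R) setT by exact: measurableT.
have r0 : 0 < Num.sqrt m by rewrite sqrtr_gt0.
have rE : Num.sqrt m ^+ 2 = m by rewrite sqr_sqrtr// ltW.
set g := fun x => ent_density (`|f x| / Num.sqrt m) in entoo *.
have mg : mfun setT g.
  have mf1 : mfun setT (fun x => `|f x| / Num.sqrt m).
    by apply: measurable_funM => //; exact: measurableT_comp.
  have mf2 : mfun setT (fun x => (`|f x| / Num.sqrt m) ^+ 2) by exact: measurable_funM.
  apply: measurable_funD => //; apply: measurable_funB => //.
  apply: measurable_funM => //.
  exact: (measurableT_comp (@measurable_ln R) mf2).
have ig : mu.-integrable setT (EFin \o g).
  apply/integrableP; split; first exact/mfun_EFinP.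
  under eq_integral do rewrite /= ger0_norm ?ent_density_ge0//.
  exact: entoo.
have pw x : f x ^+ 2 * ln (f x ^+ 2) = m * g x + ((1 + ln m) * f x ^+ 2 + - m).
  rewrite /g /ent_density exprMn exprVn rE real_normK ?num_real//.
  have [->|f0] := eqVneq (f x) 0.
    by rewrite expr0n !mul0r !mulr0; ring.
  have t0 : 0 < f x ^+ 2 by rewrite lt_neqAle sqr_ge0 andbT eq_sym sqrf_eq0.
  rewrite ln_div ?posrE//; move: (ln (f x ^+ 2)) (f x ^+ 2) => a t.
  by field; rewrite gt_eqF.
have im : mu.-integrable setT (EFin \o (fun=> - m)) by exact: finite_measure_integrable_cst.
have i3 : mu.-integrable setT (EFin \o (fun x => (1 + ln m) * f x ^+ 2)).
  exact: (integrableZl mT _ i2).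
have i4 : mu.-integrable setT (EFin \o (fun x => (1 + ln m) * f x ^+ 2 + - m)).
  exact: (integrableD mT i3 im).
have i5 : mu.-integrable setT (EFin \o (fun x => m * g x)).
  exact: (integrableZl mT _ ig).
rewrite /entropy; case: asboolP => // _.
rewrite Im /=.
have -> : (\int[mu]_x (f x ^+ 2 * ln (f x ^+ 2))%:E =
    \int[mu]_x (m * g x)%:E + \int[mu]_x ((1 + ln m) * f x ^+ 2 + - m)%:E)%E.
  rewrite -integralD//; apply: eq_integral => x _.
  by rewrite pw EFinD.
have -> : (\int[mu]_x ((1 + ln m) * f x ^+ 2 + - m)%:E = (m * ln m)%:E)%E.
  have -> : (\int[mu]_x ((1 + ln m) * f x ^+ 2 + - m)%:E =
      \int[mu]_x ((1 + ln m) * f x ^+ 2)%:E + \int[mu]_x (- m)%:E)%E.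
    by rewrite -integralD//; apply: eq_integral => x _; rewrite EFinD.
  have -> : (\int[mu]_x (- m)%:E = (- m)%:E)%E.
    by rewrite integral_cst// [X in (_ * X)%E]probability_setT mule1.
  under eq_integral do rewrite EFinM.
  rewrite (integralZl mT i2) Im -EFinM -EFinD; congr (_%:E); ring.
rewrite addeK//.
under eq_integral do rewrite EFinM.
by rewrite (integralZl mT ig).
Qed.

Lemma entropy_sqr0 : (\int[mu]_x (f x ^+ 2)%:E = 0)%E ->
  entropy mu (fun x => f x ^+ 2) = 0%E.
Proof.
move=> I0; have mf := lipschitz_near_mfun _ lf.
have mT : @measurable _ (measurableTypeR R) setT by exact: measurableT.
have mf2 : mfun setT (fun x => f x ^+ 2) by exact: measurable_funM.
have i2 : mu.-integrable setT (EFin \o (fun x => f x ^+ 2)).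
  apply/integrableP; split; first exact/mfun_EFinP.
  under eq_integral do rewrite /= ger0_norm ?sqr_ge0//.
  by rewrite I0 ltry.
rewrite /entropy; case: asboolP => // _; rewrite I0 /= mul0r sube0.
have mEf2 := (mfun_EFinP setT _).2 mf2.
have ae0 : ae_eq mu setT (EFin \o (fun x => f x ^+ 2)) (cst 0%E).
  apply/(ae_eq_integral_abs mu mT mEf2).
  by under eq_integral do rewrite /= ger0_norm ?sqr_ge0//.
rewrite (@ae_eq_integral _ (measurableTypeR R) R mu setT (cst 0%E)) ?integral0//.
- apply/mfun_EFinP; apply: measurable_funM => //.
  exact: (measurableT_comp (@measurable_ln R) mf2).
- move: ae0; apply: filterS => x /= /(_ I) [f0] _.
  by rewrite f0 mul0r.
Qed.

End scaling.
End scaled_functions.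

Theorem theorem22 (R : realType) (Phi : R -> R) (theta : R) (V : R -> R)
    (mu : probability (measurableTypeR R) R)
    (Phi_nice : nice_young Phi)
    (Phi_sconvex : strictly_convex Phi)
    (Phi_diff : forall x : R, derivable Phi x 1)
    (Phi_ge2 : {in `]0, +oo[ &,
      {homo (fun x => Phi x / x ^+ 2) : x y / x <= y}})
    (theta_gt2 : 2 < theta)
    (Phi_letheta : {in `]0, +oo[ &,
      {homo (fun x => Phi x / x `^ theta) : x y / x <= y >-> y <= x}})
    (mu_V : has_density_expN mu V)
    (V_bounded : locally_bounded V)
    (V_C2 : C2_near_infty V)
    (V1_sign : (0 < limf_einf (fun x : R => (Num.sg x * V^`()%classic x)%:E)
                              abs_infty)%E)
    (V2_V1 :
      let q := fun x : R => (V^`(2)%classic x / V^`()%classic x ^+ 2)%:E in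
      [/\ ((-1)%:E < limf_einf q abs_infty)%E,
          (limf_einf q abs_infty <= limf_esup q abs_infty)%E &
          (limf_esup q abs_infty < (1 / theta)%:E)%E])
    (V_Phi_V1 : (limf_esup (fun x : R => (V x / Phi `|V^`()%classic x|)%:E)
                           abs_infty < +oo)%E) :
  exists kappa : R, forall f : R -> R, locally_lipschitz f ->
    (entropy mu (fun x => f x ^+ 2)%R <= kappa%:E * modified_energy Phi mu f)%E.
Proof.
have Phg : young_growth Phi theta by split.
have th0 := theta_gt0 Phg.
have [c [+ /limf_einf_abs_infty[Mc Hc]]] := ereal_between _ _ V1_sign.
rewrite lte_fin => c0.
have [q [+ +]] : exists q : R, (limf_esup (fun x : R =>
    (V^`(2)%classic x / V^`()%classic x ^+ 2)%:E) (@abs_infty R) < q%:E)%E /\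
    (0 <= q /\ q * theta < 1).
  have [_ _ /ereal_between[r [qr rth]]] := V2_V1.
  (* The tail estimate needs [q >= 0], while the limit superior may be negative; raising [r] to [0]
     keeps it below [1 / theta]. *)
  exists (Num.max r 0); split.
    by rewrite (lt_le_trans qr)// lee_fin le_max lexx.
  rewrite le_max lexx orbT; split => //.
  rewrite lte_fin in rth; rewrite -ltr_pdivlMr// gt_max rth div1r invr_gt0//.
move=> /limf_esup_abs_infty[Mq Hq] [q0 qth].
have [CV0 [/limf_esup_abs_infty[MV HV] _]] := ereal_between _ _ V_Phi_V1.
have [Md Hd] := C2_lipschitz_near _ V_C2.
pose M0 := Num.max (Num.max Mc Mq) (Num.max (Num.max MV Md) 0).
(* The tails are required from [M - 2] on, which must lie strictly beyond [M0]. *)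
pose M := M0 + 3.
have [M00 McM MqM MVM MdM] : [/\ 0 <= M0, Mc <= M0, Mq <= M0, MV <= M0 & Md <= M0].
  by split; rewrite /M0 !le_max lexx ?orbT.
have Mge0 : 0 <= M by rewrite /M addr_ge0.
have Mgt0 : 0 < M by rewrite /M ltr_wpDl.
have V1pos (s x : R) : s = 1 \/ s = -1 -> M0 < s * x -> c < s * V^`()%classic x.
  move=> s1 Mx; have [xM sgx] := sg_mul_gt s x M0 M00 s1 Mx.
  have := Hc x (le_lt_trans McM xM).
  by rewrite lte_fin sgx.
have tails (s : R) : s = 1 \/ s = -1 -> tail V s (M - 2) c q.
  move=> s1 x Mx; have Mx0 : M0 < s * x by move: Mx; rewrite /M; lra.
  have [xM sgx] := sg_mul_gt s x M0 M00 s1 Mx0.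
  have [d1 l1 d2 l2] := Hd x (le_lt_trans MdM xM).
  have cV := V1pos s x s1 Mx0.
  split => //; split; first exact: ltW.
  have V1n0 : V^`()%classic x != 0.
    by apply/eqP => V10; move: cV; rewrite V10 mulr0; lra.
  have := Hq x (le_lt_trans MqM xM); rewrite lte_fin => /ltW.
  by rewrite ler_pdivrMr// lt_neqAle sqr_ge0 andbT eq_sym sqrf_eq0.
pose CV := Num.max CV0 0.
have CVge0 : 0 <= CV by rewrite /CV le_max lexx orbT.
have V_Phi (s x : R) : s = 1 \/ s = -1 -> M <= s * x ->
    V x <= CV * Phi (s * V^`()%classic x).
  move=> s1 Mx; have Mx0 : M0 < s * x by move: Mx; rewrite /M; lra.
  have [xM sgx] := sg_mul_gt s x M0 M00 s1 Mx0.
  have cV := V1pos s x s1 Mx0.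
  have sV0 : 0 < s * V^`()%classic x by rewrite (lt_trans c0).
  have absV : `|V^`()%classic x| = s * V^`()%classic x.
    rewrite -(gtr0_norm sV0) normrM.
    by case: s1 => ->; rewrite ?normrN normr1 mul1r.
  have := HV x (le_lt_trans MVM xM); rewrite absV lte_fin => /ltW.
  rewrite ler_pdivrMr ?(young_gt0 Phg)// => /le_trans; apply.
  by rewrite ler_wpM2r ?(young_ge0 Phg)// /CV le_max lexx.
have [BV V_bnd] := locally_bounded_itv V M V_bounded.
have muM := mu_itv_gt0 V mu M BV mu_V Mgt0 V_bnd.
have mO1 : @measurable _ (measurableTypeR R) (oriented_itv 1 (- M) M) by apply: measurable_oriented_itv; left.
have muMoo : (mu (oriented_itv 1 (- M) M) < +oo)%E.
  by rewrite (le_lt_trans (probability_le1 mu mO1))// ltry.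
have [K K1 KM] := exists_level _ muM muMoo.
have [kappa kappa0 main] := entropy_normalized Phg V mu mu_V M c q CV BV Mge0 c0 q0 qth
  tails V_Phi CVge0 V_bnd K K1 KM.
(* A positive constant is needed when the energy is infinite, because [0 * +oo] is [0]. *)
exists (kappa + 1) => f lipf.
have kp : 0 < kappa + 1 by rewrite ltr_wpDl.
have lf x : lipschitz_near f x := locally_lipschitz_lipschitz_near f x lipf.
have Ele := seq_energy_le Phg mu f lf.
have E0 : (0 <= \int[mu]_x (seq_energy (Phi := Phi) f x)%:E)%E.
  by apply: integral_ge0 => x _; rewrite lee_fin (seq_energy_ge0 Phg).
have [->|Eoo] := eqVneq (modified_energy Phi mu f) +oo%E.
  by rewrite gt0_muley ?lte_fin// leey.
have Efin : (\int[mu]_x (seq_energy (Phi := Phi) f x)%:E)%E \is a fin_num.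
  by rewrite ge0_fin_numE// (le_lt_trans Ele)// ltey.
set E := fine (\int[mu]_x (seq_energy (Phi := Phi) f x)%:E)%E.
have EE : (\int[mu]_x (seq_energy (Phi := Phi) f x)%:E = E%:E)%E by rewrite fineK.
have Er0 : 0 <= E by rewrite fine_ge0.
(* The scale [1] comes first: the normalising scale, the square root of [int f^2], is available only
   once [poincare] has shown that [f^2] is integrable. *)
have ed1 := scaled_energy_data Phg mu f lf 1 E ltr01 EE.
have zM : `|0 : R| <= M by rewrite normr0.
have P1 := poincare Phg V mu mu_V M c q BV Mge0 c0 tails V_bnd _ _ _ _ 0 ed1 zM.
have i2 : mu.-integrable setT (EFin \o (fun x => f x ^+ 2)).
  apply: (integrable_sqr mu f lf _ _ (le_trans _ P1)).
  by under [leRHS]eq_integral do rewrite divr1.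
pose m := fine (\int[mu]_x (f x ^+ 2)%:E)%E.
have mE : (\int[mu]_x (f x ^+ 2)%:E = m%:E)%E.
  by rewrite fineK//; exact: (integrable_fin_num _ i2).
have mge0 : 0 <= m by rewrite fine_ge0// integral_ge0// => x _; rewrite lee_fin sqr_ge0.
have [m0|mn0] := eqVneq m 0.
  rewrite (entropy_sqr0 mu f lf); last by rewrite mE m0.
  by rewrite mule_ge0 ?lee_fin ?(ltW kp)// (le_trans E0 Ele).
have mp : 0 < m by rewrite lt_neqAle eq_sym mn0.
have r0 : 0 < Num.sqrt m by rewrite sqrtr_gt0.
have rE : Num.sqrt m ^+ 2 = m by rewrite sqr_sqrtr.
have edr := scaled_energy_data Phg mu f lf (Num.sqrt m) E r0 EE.
have norm1 : (\int[mu]_x ((`|f x| / Num.sqrt m) ^+ 2)%:E = 1)%E.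
  have -> : (\int[mu]_x ((`|f x| / Num.sqrt m) ^+ 2)%:E =
      \int[mu]_x ((m^-1)%:E * (EFin \o (fun x => (f x ^+ 2)%R)) x))%E.
    apply: eq_integral => x _; rewrite /= -EFinM exprMn exprVn rE.
    by rewrite real_normK ?num_real// mulrC.
  have mT : @measurable _ (measurableTypeR R) setT by exact: measurableT.
  by rewrite (integralZl mT i2) /= mE -EFinM mulVf.
have B := main _ _ _ _ edr norm1.
rewrite (entropy_sqr mu f lf m i2 mE mp); last by rewrite (le_lt_trans B)// ltry.
apply: (@le_trans _ _ (m%:E * (kappa * (E / Num.sqrt m ^+ 2))%:E)%E).
  by rewrite lee_wpmul2l ?lee_fin.
rewrite rE -EFinM (_ : m * (kappa * (E / m)) = kappa * E); last by field.
rewrite EFinM -EE.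
apply: (@le_trans _ _ (kappa%:E * modified_energy Phi mu f)%E).
  by rewrite lee_wpmul2l ?lee_fin.
apply: lee_wpmul2r; first exact: le_trans E0 Ele.
by rewrite lee_fin lerDl.
Qed.
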